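(* Let $M$ be an $E$-$E$-bimodule with $M_{cyc}=0$ and with a decomposition $M=N\oplus M'$ as $E$-$E$-bimodules, where $N$ is $2$-cycle complete with respect to $U$, a set of directed generators of $N$, with associated polarization $\mathcal A$ and bijections $a\mapsto\hat a$. Let $\mathcal L$ be the closure of the two-sided ideal in $\mathcal F_E(M)$ generated by $N$. Suppose that for any positive integer $l$ and any potential in $\mathcal L\cap\mathcal F_E(M)^{\geq l}$ of the form $$\sum_{(i,j)\in\mathcal A}\ \sum_{a\in U(i,j)}(au_a+v_{\hat a}\hat a)+z,\qquad z\in[\mathcal F_E(M),\mathcal F_E(M)]\cap\mathcal F_E(M)^{\geq l},$$ where $u_a,v_{\hat a}\in\mathcal F_E(M)$, there is a morphism of $E$-$E$-bimodules $\rho:N\to\mathcal F_E(M)$ with $\rho(a)=-v_{\hat a}$ and $\rho(\hat a)=-u_a$ for all $a\in U(\mathcal A)$. Then for any potential of the form $P=Q_N+P^{\geq3}$ with $P^{\geq3}\in\mathcal F_E(M)^{\geq3}$, there exists an algebra automorphism $\varphi$ of $\mathcal F_E(M)$, with $\varphi|_E=\mathrm{id}_E$, such that $\varphi(P)$ is cyclically equivalent to a potential $Q_N+Q$ with $Q\in\mathcal F_E(M')^{\geq3}$.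
   Context: $F$ is a field, $E=\prod_{i=1}^nE_i$ where each $E_i$ is a finite-dimensional semisimple $F$-algebra and $E\otimes_FE^{op}$ is a semisimple $F$-algebra; $e_i\in E$ is the image of the identity of $E_i$. All $E$-$E$-bimodules $M$ considered are finite-dimensional over $F$ with $F$ acting centrally, and acyclic: $M_{cyc}:=\sum_ie_iMe_i=0$. $\mathcal{F}_E(M)=\prod_{i\ge 0}M^{\otimes i}$ (tensor powers over $E$, $M^{\otimes0}=E$), with product $(fg)(i)=\sum_{s+t=i}f(s)g(t)$ ($f(i)$ is the degree $i$ component) and the topology of the metric $d(f,g)=2^{-\nu(f-g)}$ for $f\neq g$, $d(f,f)=0$, where $\nu(h)=\min\{i:h(i)\ne0\}$. $\mathcal F_E(M)^{\ge i}$ is the set of $f$ with $f(j)=0$ for $j<i$. A potential is an element $P$ with $P=\sum_ie_iPe_i$. $[\mathcal F_E(M),\mathcal F_E(M)]$ is the closure of the $F$-span of all $fg-gf$; two potentials are cyclically equivalent if their difference lies in it. $\mathcal F_E(M')$ is viewed inside $\mathcal F_E(M)$ for $M'\subseteq M$ a direct summand. An element $f$ is directed if $f=e_jfe_i$ for some $i,j$. A polarization of a bimodule $N$ is a set $\mathcal A\subseteq\{1,\dots,n\}^2$ such that (i) $(i,j)\in\mathcal A$ implies $e_iNe_j\neq0$ and $(j,i)\notin\mathcal A$; (ii) $e_iNe_j\neq0$ implies $(i,j)\in\mathcal A$ or $(j,i)\in\mathcal A$. If $U$ is a set of directed generators of $N$ and $U(i,j)=U\cap e_iNe_j$, then $N$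 is $2$-cycle complete with respect to $U$ if there is a polarization $\mathcal A$ of $N$ and for each $(i,j)\in\mathcal A$ a bijection $\hat{\ }:U(i,j)\to U(j,i)$. In this case $U(\mathcal A)=\bigcup_{(i,j)\in\mathcal A}U(i,j)$ and $Q_N=\sum_{a\in U(\mathcal A)}a\hat a$. *)

(* Defs.v *)
From HB Require Import structures.
From mathcomp Require Import all_boot all_order all_algebra.
From mathcomp Require Import falgebra boolp classical_sets.

Set Implicit Arguments.
Unset Strict Implicit.
Unset Printing Implicit Defensive.

Import GRing.Theory VectorInternalTheory.

Local Open Scope ring_scope.

(* V / W is realized on the complement W^C of W: the coset v + W is           *)
(* represented by the component of v along W^C.                               *)
Section QuotientSpace.
Variables (F : fieldType) (V : vectType F) (W : {vspace V}).

Definition quotv : Type := subvs_of (W^C)%VS.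
HB.instance Definition _ := Vector.on quotv.

Definition quot_pi (v : V) : quotv := vsproj (W^C)%VS (daddv_pi (W^C)%VS W v).
Definition quot_repr (q : quotv) : V := vsval q.

Fact quot_pi_is_linear : linear quot_pi.
Proof. by move=> a u v; rewrite /quot_pi linearP linearP. Qed.
HB.instance Definition _ :=
  GRing.isSemilinear.Build F V quotv _ quot_pi
    (GRing.semilinear_linear quot_pi_is_linear).

Fact quot_repr_is_linear : linear quot_repr.
Proof. by move=> a u v; rewrite /quot_repr linearP. Qed.
HB.instance Definition _ :=
  GRing.isSemilinear.Build F quotv V _ quot_repr
    (GRing.semilinear_linear quot_repr_is_linear).

Let capWC : (W^C :&: W = 0)%VS.
Proof. by rewrite capvC capv_compl. Qed.

Lemma quot_reprK q : quot_pi (quot_repr q) = q.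
Proof. by rewrite /quot_pi daddv_pi_id ?vsvalK ?subvsP. Qed.

Lemma quot_pi_eq0 v : (quot_pi v == 0) = (v \in W).
Proof.
have Dv : daddv_pi (W^C)%VS W v + daddv_pi W (W^C)%VS v = v.
  by apply: daddv_pi_add => //; rewrite addvC addv_complf memvf.
apply/eqP/idP => [/(congr1 vsval) | Wv].
  rewrite linear0 vsprojK ?memv_pi // => v0.
  by rewrite -Dv v0 add0r memv_pi.
apply: val_inj; rewrite /= vsprojK ?memv_pi //.
apply: (addIr (daddv_pi W (W^C)%VS v)); rewrite Dv add0r.
by rewrite daddv_pi_id // capv_compl.
Qed.

Lemma quot_piK v : quot_repr (quot_pi v) - v \in W.
Proof. by rewrite -quot_pi_eq0 linearB /= quot_reprK subrr. Qed.

End QuotientSpace.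

(* U (x)_F V is the space of matrices over the standard bases of U and V,     *)
(* with u (x) v the product of a column by a row.                             *)
Section StandardBasis.
Variable F : fieldType.

Definition stdb (T : vectType F) (i : 'I_(dim T)) : T := r2v (delta_mx 0 i).

Lemma stdb_sum (T : vectType F) (x : T) :
  x = \sum_i v2r x 0 i *: stdb i.
Proof.
rewrite -{1}[x]v2rK {1}[v2r x]row_sum_delta linear_sum /=.
by apply: eq_bigr => i _; rewrite linearZ.
Qed.

Lemma linear_sumZ (T : vectType F) (W : lmodType F) (f : T -> W) x : linear f ->
  f x = \sum_i v2r x 0 i *: f (stdb i).
Proof.
move=> fl; pose fL : {linear T -> W} := HB.pack f
  (GRing.isSemilinear.Build F T W _ f (GRing.semilinear_linear fl)).
rewrite {1}[x]stdb_sum -[f]/(fL : T -> W) linear_sum.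
by apply: eq_bigr => i _; rewrite linearZ.
Qed.

Lemma linear_mem (T W : vectType F) (X : {vspace W}) (f : T -> W) x : linear f ->
  (forall i, f (stdb i) \in X) -> f x \in X.
Proof.
move=> fl fX; rewrite (linear_sumZ _ fl).
by apply: rpred_sum => i _; rewrite rpredZ.
Qed.

End StandardBasis.

Section TensorF.
Variables (F : fieldType) (U V : vectType F).

Definition tensF : Type := 'M[F]_(dim U, dim V).
HB.instance Definition _ := Vector.on tensF.

Definition tF (u : U) (v : V) : tensF := (v2r u)^T *m v2r v.

Lemma tF_linl v : linear (tF^~ v).
Proof. by move=> a x y; rewrite /tF linearP linearP /= mulmxDl scalemxAl. Qed.
Lemma tF_linr u : linear (tF u).
Proof. by move=> a x y; rewrite /tF linearP /= mulmxDr scalemxAr. Qed.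

Definition bilin (W : lmodType F) (f : U -> V -> W) :=
  (forall v, linear (f^~ v)) /\ (forall u, linear (f u)).

(* The linear map U (x) V -> W induced by the bilinear map f. *)
Definition tlift (W : lmodType F) (f : U -> V -> W) (p : tensF) : W :=
  \sum_i \sum_j (p : 'M[F]__) i j *: f (stdb i) (stdb j).

Lemma tlift_is_linear (W : lmodType F) (f : U -> V -> W) : linear (tlift f).
Proof.
move=> a p q; rewrite /tlift scaler_sumr -big_split /=.
apply: eq_bigr => i _; rewrite scaler_sumr -big_split /=.
by apply: eq_bigr => j _; rewrite !mxE scalerDl scalerA.
Qed.
HB.instance Definition _ (W : lmodType F) (f : U -> V -> W) :=
  GRing.isSemilinear.Build F tensF W _ (tlift f)
    (GRing.semilinear_linear (tlift_is_linear f)).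

Lemma tlift_comb (W : lmodType F) (f g h : U -> V -> W) k p :
    (forall u v, f u v = k *: g u v + h u v) ->
  tlift f p = k *: tlift g p + tlift h p.
Proof.
move=> fgh; rewrite /tlift scaler_sumr -big_split; apply: eq_bigr => i _.
rewrite scaler_sumr -big_split; apply: eq_bigr => j _ /=.
by rewrite fgh scalerDr !scalerA mulrC.
Qed.

Lemma bilin_sum (W : lmodType F) (f : U -> V -> W) u v : bilin f ->
  f u v = \sum_i \sum_j (v2r u 0 i * v2r v 0 j) *: f (stdb i) (stdb j).
Proof.
case=> fl fr; rewrite (linear_sumZ _ (fl v)); apply: eq_bigr => i _.
rewrite (linear_sumZ _ (fr _)) scaler_sumr.
by apply: eq_bigr => j _; rewrite scalerA.
Qed.

Lemma tliftE (W : lmodType F) (f : U -> V -> W) u v :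
  bilin f -> tlift f (tF u v) = f u v.
Proof.
move=> fB; rewrite (bilin_sum _ _ fB) /tlift; apply: eq_bigr => i _.
by apply: eq_bigr => j _; rewrite /tF !mxE big_ord1 !mxE.
Qed.

Lemma tF_bilin : bilin tF.
Proof. by split=> [v|u]; [apply: tF_linl | apply: tF_linr]. Qed.

Lemma tlift_tF p : tlift tF p = p.
Proof.
apply/matrixP => k l; rewrite /tlift summxE (bigD1 k) //= summxE (bigD1 l) //=.
rewrite /tF !mxE big_ord1 !mxE /stdb !r2vK !mxE !eqxx !mulr1.
rewrite !big1 ?addr0 // => [i ik | j jl].
- rewrite summxE big1 // => j _.
  by rewrite !mxE big_ord1 !mxE !r2vK !mxE eqxx /= [k == i]eq_sym (negPf ik)
             mul0r mulr0.
- by rewrite !mxE big_ord1 !mxE !r2vK !mxE eqxx /= [l == j]eq_sym (negPf jl)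
             !mulr0.
Qed.

Lemma tensF_ind (P : tensF -> Prop) :
  P 0 -> (forall a u v p, P p -> P (a *: tF u v + p)) -> forall p, P p.
Proof.
move=> P0 PD p; rewrite -[p]tlift_tF /tlift pair_big /=.
by elim/big_rec: _ => // ij q _; apply: PD.
Qed.

Lemma tensF_ext (W : lmodType F) (f g : {linear tensF -> W}) :
  (forall u v, f (tF u v) = g (tF u v)) -> f =1 g.
Proof.
by move=> fg; elim/tensF_ind => [|a u v p IH]; rewrite ?linear0 // !linearP fg IH.
Qed.

End TensorF.

Section TensorAlgebra.
Variables (F : fieldType) (A B : falgType F).

Definition tens_alg : Type := tensF A B.
HB.instance Definition _ := Vector.on tens_alg.

Definition ta_mul (p q : tens_alg) : tens_alg :=
  tlift (fun a b => tlift (fun a' b' => tF (a * a') (b * b')) q) p.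
Definition ta_one : tens_alg := tF 1 1.

Fact ta_bilin2 a b : bilin (fun a' b' => tF (a * a') (b * b') : tensF A B).
Proof.
split=> [v k x y|u k x y].
  by rewrite mulrDr -scalerAr (tF_linl _ k).
by rewrite mulrDr -scalerAr (tF_linr _ k).
Qed.

Fact ta_bilin1 q :
  bilin (fun a b => tlift (fun a' b' => tF (a * a') (b * b')) q : tensF A B).
Proof.
split=> [v k x y|u k x y]; elim/tensF_ind: q => [|c a b q IH] /=.
- by rewrite !linear0 addr0.
- rewrite !tlift_is_linear {}IH !tliftE; try exact: ta_bilin2.
  rewrite mulrDl -scalerAl (tF_linl _ k) !scalerDr !scalerA [c * k]mulrC.
  by rewrite addrACA.
- by rewrite !linear0 addr0.
- rewrite !tlift_is_linear {}IH !tliftE; try exact: ta_bilin2.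
  rewrite mulrDl -scalerAl (tF_linr _ k) !scalerDr !scalerA [c * k]mulrC.
  by rewrite addrACA.
Qed.

Lemma ta_mulE a b a' b' :
  ta_mul (tF a b) (tF a' b') = tF (a * a') (b * b').
Proof. by rewrite /ta_mul !tliftE //; [apply: ta_bilin2 | apply: ta_bilin1]. Qed.

Fact ta_mulPl q : linear (ta_mul^~ q).
Proof. by move=> c p p'; rewrite /ta_mul linearP. Qed.
Fact ta_mulPr p : linear (ta_mul p).
Proof.
by move=> c q q'; apply: tlift_comb => a b; apply: tlift_is_linear.
Qed.

Fact ta_mul0l q : ta_mul 0 q = 0. Proof. exact: linear0. Qed.
Fact ta_mul0r p : ta_mul p 0 = 0.
Proof. by have := ta_mulPr p (-1) 0 0; rewrite scaler0 addr0 scaleN1r addNr. Qed.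

Fact ta_mulA : associative ta_mul.
Proof.
move=> p q r; elim/tensF_ind: p => [|c a b p IHp]; first by rewrite !ta_mul0l.
rewrite !ta_mulPl IHp; congr (_ *: _ + _) => {p IHp c}.
elim/tensF_ind: q => [|c a' b' q IHq]; first by rewrite !(ta_mul0r, ta_mul0l).
rewrite !(ta_mulPl, ta_mulPr) IHq; congr (_ *: _ + _) => {q IHq c}.
elim/tensF_ind: r => [|c a2 b2 r IHr]; first by rewrite !ta_mul0r.
by rewrite !ta_mulPr IHr !ta_mulE !mulrA.
Qed.

Fact ta_mul1 : left_id ta_one ta_mul.
Proof.
elim/tensF_ind=> [|c a b p IH]; first by rewrite ta_mul0r.
by rewrite ta_mulPr IH ta_mulE !mul1r.
Qed.
Fact ta_mulr1 : right_id ta_one ta_mul.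
Proof.
elim/tensF_ind=> [|c a b p IH]; first by rewrite ta_mul0l.
by rewrite ta_mulPl IH ta_mulE !mulr1.
Qed.
Fact ta_mulDl : left_distributive ta_mul +%R.
Proof. by move=> p q r; have := ta_mulPl r 1 p q; rewrite !scale1r. Qed.
Fact ta_mulDr : right_distributive ta_mul +%R.
Proof. by move=> p q r; have := ta_mulPr p 1 q r; rewrite !scale1r. Qed.

Fact ta_one_neq0 : ta_one != 0.
Proof.
have n0 (T : falgType F) : exists i, v2r (1 : T) 0 i != 0.
  have /matrix0Pn[i [j ij]] : v2r (1 : T) != 0.
    by rewrite -(inj_eq (@r2v_inj _ T)) v2rK linear0 oner_eq0.
  by exists j; rewrite -(ord1 i).
have [[i i0] [j j0]] := (n0 A, n0 B).
apply/matrix0Pn; exists i, j; rewrite /ta_one /tF !mxE big_ord1 !mxE.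
by rewrite mulf_neq0.
Qed.

HB.instance Definition _ := GRing.Zmodule_isNzRing.Build tens_alg
  ta_mulA ta_mul1 ta_mulr1 ta_mulDl ta_mulDr ta_one_neq0.

Fact ta_scaleAl k (p q : tens_alg) : k *: (p * q) = (k *: p) * q.
Proof.
have := ta_mulPl q k p 0; rewrite ta_mul0l !addr0 => H; exact: esym H.
Qed.
HB.instance Definition _ := GRing.Lmodule_isLalgebra.Build F tens_alg ta_scaleAl.
Fact ta_scaleAr k (p q : tens_alg) : k *: (p * q) = p * (k *: q).
Proof.
have := ta_mulPr p k q 0; rewrite ta_mul0r !addr0 => H; exact: esym H.
Qed.
HB.instance Definition _ := GRing.Lalgebra_isAlgebra.Build F tens_alg ta_scaleAr.
HB.instance Definition _ := Algebra_isFalgebra.Build F tens_alg.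

End TensorAlgebra.

Section OppositeAlgebra.
Variables (F : fieldType) (E : falgType F).

HB.instance Definition _ := Vector.copy E^c E.
Fact conv_scaleAl k (p q : E^c) : k *: (p * q : E^c) = (k *: p : E^c) * q.
Proof. exact: (@scalerAr F E k q p). Qed.
HB.instance Definition _ := GRing.Lmodule_isLalgebra.Build F E^c conv_scaleAl.
Fact conv_scaleAr k (p q : E^c) : k *: (p * q : E^c) = p * (k *: q : E^c).
Proof. exact: (@scalerAl F E k q p). Qed.
HB.instance Definition _ := GRing.Lalgebra_isAlgebra.Build F E^c conv_scaleAr.
HB.instance Definition _ := Falgebra.on E^c.

Lemma env_mulE (a b a' b' : E) :
  (tF (a : E) (b : E^c) : tens_alg E E^c) * (tF (a' : E) (b' : E^c) : tens_alg E E^c)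
  = (tF (a * a' : E) (b' * b : E) : tensF E E).
Proof. exact: (@ta_mulE F E E^c). Qed.

End OppositeAlgebra.
(* F-bilinearity of both actions says that F acts centrally.                  *)
HB.mixin Record isBimodule (F : fieldType) (E : falgType F) M of Vector F M := {
  lact : E -> M -> M;
  ract : M -> E -> M;
  lact_linl : forall m, linear (fun x => lact x m);
  lact_linr : forall x, linear (lact x);
  ract_linl : forall x, linear (fun m => ract m x);
  ract_linr : forall m, linear (ract m);
  lact1 : forall m, lact 1 m = m;
  ract1 : forall m, ract m 1 = m;
  lactA : forall x y m, lact (x * y) m = lact x (lact y m);
  ractA : forall x y m, ract m (x * y) = ract (ract m x) y;
  lractA : forall x y m, ract (lact x m) y = lact x (ract m y)
}.

#[short(type="bimodType")]
HB.structure Definition Bimodule (F : fieldType) (E : falgType F) :=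
  { M of isBimodule F E M & Vector F M }.

Section RegularBimodule.
Variables (F : fieldType) (E : falgType F).

Definition regbimod : Type := E.
HB.instance Definition _ := Vector.on regbimod.

Fact reg_linl (y : E) : linear (fun x : E => x * y).
Proof. by move=> k u v; rewrite mulrDl scalerAl. Qed.
Fact reg_linr (x : E) : linear (fun y : E => x * y).
Proof. by move=> k u v; rewrite mulrDr scalerAr. Qed.

HB.instance Definition _ := isBimodule.Build F E regbimod
  reg_linl reg_linr reg_linl reg_linr (@mul1r E) (@mulr1 E)
  (fun x y m => esym (mulrA x y m)) (fun x y m => mulrA m x y)
  (fun x y m => esym (mulrA x m y)).

End RegularBimodule.

Section TensorE.
Variables (F : fieldType) (E : falgType F) (M N : bimodType E).

(* By trilinearity it is enough to take m, x, n in bases: see [balanced_mem]. *)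
Definition balanced : {vspace tensF M N} :=
  (\sum_(i < dim M) \sum_(j < dim E) \sum_(k < dim N)
    <[tF (ract (stdb i) (stdb j : E)) (stdb k)
      - tF (stdb i) (lact (stdb j : E) (stdb k))]>)%VS.

Definition tensE : Type := quotv balanced.
HB.instance Definition _ := Vector.on tensE.

Definition tE (m : M) (n : N) : tensE := quot_pi balanced (tF m n).

Lemma balanced_mem m (x : E) n : tF (ract m x) n - tF m (lact x n) \in balanced.
Proof.
apply: (linear_mem (f := fun m => tF (ract m x) n - tF m (lact x n))) => [k u v|i].
  by rewrite ract_linl !tF_linl scalerBr addrACA opprD.
apply: (linear_mem (f := fun x => tF (ract _ x) n - tF _ (lact x n))) => [k u v|j].
  by rewrite ract_linr lact_linl tF_linl tF_linr scalerBr addrACA opprD.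
apply: (linear_mem (f := fun n => tF _ n - tF _ (lact _ n))) => [k u v|l].
  by rewrite lact_linr !tF_linr scalerBr addrACA opprD.
rewrite memvE; apply: (sumv_sup i) => //; apply: (sumv_sup j) => //.
by apply: (sumv_sup l).
Qed.

Lemma balanced_min (X : {vspace tensF M N}) :
  (forall m (x : E) n, tF (ract m x) n - tF m (lact x n) \in X) ->
  (balanced <= X)%VS.
Proof.
move=> HX; apply/subv_sumP => i _; apply/subv_sumP => j _.
by apply/subv_sumP => k _; rewrite -memvE.
Qed.

Lemma tE_bilin : bilin tE.
Proof.
by split=> [v k x y|u k x y]; rewrite /tE ?tF_linl ?tF_linr linearP.
Qed.

Lemma tE_bal m (x : E) n : tE (ract m x) n = tE m (lact x n).
Proof.
by apply/eqP; rewrite -subr_eq0 -linearB quot_pi_eq0 balanced_mem.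
Qed.

Lemma tensE_ind (P : tensE -> Prop) :
  P 0 -> (forall a m n q, P q -> P (a *: tE m n + q)) -> forall q, P q.
Proof.
move=> P0 PD q; rewrite -[q]quot_reprK.
elim/tensF_ind: (quot_repr q) => [|a m n p IH]; first by rewrite linear0.
by rewrite linearP; apply: PD.
Qed.

Lemma tensE_ext (W : lmodType F) (f g : tensE -> W) : linear f -> linear g ->
  (forall m n, f (tE m n) = g (tE m n)) -> f =1 g.
Proof.
move=> fl gl fg; elim/tensE_ind => [|a m n q IH]; last by rewrite fl gl fg IH.
have z (h : tensE -> W) : linear h -> h 0 = 0.
  by move=> hl; have := hl (-1) 0 0; rewrite scaler0 addr0 scaleN1r addNr.
by rewrite !z.
Qed.

(* The linear map on M (x)_E N induced by an E-balanced bilinear map. *)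
Definition elift (W : lmodType F) (f : M -> N -> W) (q : tensE) : W :=
  tlift f (quot_repr q).

Lemma elift_linear (W : lmodType F) (f : M -> N -> W) : linear (elift f).
Proof. by move=> a p q; rewrite /elift quot_repr_is_linear tlift_is_linear. Qed.

Lemma eliftE (W : lmodType F) (f : M -> N -> W) m n : bilin f ->
  (forall m (x : E) n, f (ract m x) n = f m (lact x n)) ->
  elift f (tE m n) = f m n.
Proof.
move=> fB fb; rewrite -(tliftE m n fB) /elift /tE; apply/eqP; rewrite -subr_eq0.
have := quot_piK balanced (tF m n); rewrite -linearB; move: (_ - _) => p.
rewrite /balanced => /memv_sumP[p1 Hp ->]; rewrite linear_sum big1 // => i _.
have /memv_sumP[p2 Hp2 ->] := Hp i isT; rewrite linear_sum big1 // => j _.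
have /memv_sumP[p3 Hp3 ->] := Hp2 j isT; rewrite linear_sum big1 // => k _.
have /vlineP[c ->] := Hp3 k isT.
by rewrite linearZ linearB /= !tliftE // fb subrr scaler0.
Qed.

Definition tE_lact (x : E) : tensE -> tensE := elift (fun m n => tE (lact x m) n).
Definition tE_ract (q : tensE) (x : E) : tensE :=
  elift (fun m n => tE m (ract n x)) q.

Lemma tE_lactE x m n : tE_lact x (tE m n) = tE (lact x m) n.
Proof.
rewrite /tE_lact eliftE // => [|{}m y {}n]; last by rewrite -lractA tE_bal.
split=> [v k a b|u k a b].
  by rewrite lact_linr; case: tE_bilin => ->.
by case: tE_bilin => _ ->.
Qed.

Lemma tE_ractE m n x : tE_ract (tE m n) x = tE m (ract n x).
Proof.
rewrite /tE_ract eliftE // => [|{}m y {}n]; last by rewrite tE_bal lractA.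
split=> [v k a b|u k a b].
  by case: tE_bilin => ->.
by rewrite ract_linl; case: tE_bilin => _ ->.
Qed.

Fact tE_lact_linr x : linear (tE_lact x). Proof. exact: elift_linear. Qed.
Fact tE_ract_linl x : linear (fun q => tE_ract q x).
Proof. exact: elift_linear. Qed.
Fact tE_lact_linl q : linear (fun x => tE_lact x q).
Proof.
move=> k x y; apply: tlift_comb => m n.
by rewrite lact_linl; case: tE_bilin => ->.
Qed.
Fact tE_ract_linr q : linear (tE_ract q).
Proof.
move=> k x y; apply: tlift_comb => m n.
by rewrite ract_linr; case: tE_bilin => _ ->.
Qed.

Fact linear_id (V : lmodType F) : linear (@id V). Proof. by []. Qed.
Fact linear_comp (U V W : lmodType F) (f : V -> W) (g : U -> V) :
  linear f -> linear g -> linear (fun x => f (g x)).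
Proof. by move=> fl gl k x y; rewrite gl fl. Qed.

Fact tE_lact1 q : tE_lact 1 q = q.
Proof.
apply: (tensE_ext (tE_lact_linr 1) (@linear_id _)) => m n.
by rewrite tE_lactE lact1.
Qed.
Fact tE_ract1 q : tE_ract q 1 = q.
Proof.
apply: (tensE_ext (tE_ract_linl 1) (@linear_id _)) => m n.
by rewrite tE_ractE ract1.
Qed.
Fact tE_lactA x y q : tE_lact (x * y) q = tE_lact x (tE_lact y q).
Proof.
apply: (tensE_ext (tE_lact_linr _)
  (linear_comp (tE_lact_linr x) (tE_lact_linr y))) => m n.
by rewrite !tE_lactE lactA.
Qed.
Fact tE_ractA x y q : tE_ract q (x * y) = tE_ract (tE_ract q x) y.
Proof.
apply: (tensE_ext (tE_ract_linl _)
  (linear_comp (tE_ract_linl y) (tE_ract_linl x))) => m n.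
by rewrite !tE_ractE ractA.
Qed.
Fact tE_lractA x y q : tE_ract (tE_lact x q) y = tE_lact x (tE_ract q y).
Proof.
apply: (tensE_ext (linear_comp (tE_ract_linl y) (tE_lact_linr x))
  (linear_comp (tE_lact_linr x) (tE_ract_linl y))) => m n.
by rewrite !(tE_lactE, tE_ractE).
Qed.

HB.instance Definition _ := isBimodule.Build F E tensE
  tE_lact_linl tE_lact_linr tE_ract_linl tE_ract_linr
  tE_lact1 tE_ract1 tE_lactA tE_ractA tE_lractA.

End TensorE.

(* M^{(x) 1} is M (x)_E E here, identified with M by m |-> m (x) 1 as in      *)
(* [iotaM] below.                                                             *)
Section TensorPowers.
Variables (F : fieldType) (E : falgType F) (M : bimodType E).

Fixpoint tpow (i : nat) : bimodType E :=
  if i is i'.+1 then tensE M (tpow i') : bimodType E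
  else regbimod E : bimodType E.

Definition tcast i j (e : i = j) (x : tpow i) : tpow j := ecast k (tpow k) e x.

(* Concatenation M^{(x) s} x M^{(x) t} -> M^{(x) (s + t)}:                    *)
(* e . y = e y for e in E, and (m (x) x) . y = m (x) (x . y).                 *)
Fixpoint tmul s t : tpow s -> tpow t -> tpow (s + t) :=
  match s return tpow s -> tpow t -> tpow (s + t) with
  | 0 => fun x y => lact (x : E) y
  | s'.+1 => fun x y => elift (fun m x' => tE m (tmul x' y)) x
  end.

Lemma tmul_linl s t (y : tpow t) : linear (fun x : tpow s => tmul x y).
Proof.
case: s => [|s] /=; first exact: (@lact_linl _ _ (tpow t) y).
exact: elift_linear.
Qed.

Lemma tmul_linr s t (x : tpow s) : linear (@tmul s t x).
Proof.
elim: s x => [|s IH] x k y z /=; first exact: lact_linr.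
apply: tlift_comb => m x'; rewrite IH.
by case: (tE_bilin M (tpow (s + t))) => _ ->.
Qed.

Fact tmul_aux s t (y : tpow t) :
  bilin (fun m (x : tpow s) => tE m (tmul x y) : tpow (s + t).+1).
Proof.
have [bl br] := tE_bilin M (tpow (s + t)).
split=> [v k a b|u k a b]; first exact: bl.
by rewrite tmul_linl; apply: br.
Qed.

Lemma tmul_lact s t (e : E) (x : tpow s) (y : tpow t) :
  tmul (lact e x) y = lact e (tmul x y).
Proof.
elim: s e x => [|s IH] e x /=; first exact: lactA.
move: x; apply: tensE_ext => [||m x].
- apply: linear_comp; first exact: elift_linear.
  exact: lact_linr.
- apply: linear_comp; first exact: (@lact_linr _ _ (tensE M (tpow (s + t)))).
  exact: elift_linear.
have bal (m' : M) (e' : E) (x' : tpow s) :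
    tE (ract m' e') (tmul x' y) = tE m' (tmul (lact e' x') y).
  by rewrite tE_bal IH.
rewrite [lact e (tE m x)]tE_lactE !eliftE //; try exact: tmul_aux.
by rewrite [RHS]tE_lactE.
Qed.

Lemma tmulS s t m (x : tpow s) (y : tpow t) :
  tmul (tE m x : tpow s.+1) y = tE m (tmul x y).
Proof.
rewrite /= eliftE //; first exact: tmul_aux.
by move=> m' e x'; rewrite tE_bal tmul_lact.
Qed.

Lemma tmul_bal s t (e : E) (x : tpow s) (y : tpow t) :
  tmul (ract x e) y = tmul x (lact e y).
Proof.
elim: s x => [|s IH] x; first exact: lactA.
move: x; apply: (@tensE_ext _ _ M (tpow s)) => [||m x].
- apply: (linear_comp (f := fun x : tpow s.+1 => tmul x y)).
    exact: tmul_linl.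
  exact: (@ract_linl _ _ (tpow s.+1)).
- exact: (tmul_linl (s := s.+1)).
by rewrite [ract (tE m x) e]tE_ractE !tmulS IH.
Qed.

Lemma tmul_ract s t (e : E) (x : tpow s) (y : tpow t) :
  tmul x (ract y e) = ract (tmul x y) e.
Proof.
elim: s x => [|s IH] x; first by rewrite /= lractA.
move: x; apply: (@tensE_ext _ _ M (tpow s)) => [||m x].
- exact: (tmul_linl (s := s.+1)).
- apply: (linear_comp (f := fun z : tpow (s.+1 + t) => ract z e)).
    exact: (@ract_linl _ _ (tpow (s.+1 + t))).
  exact: (tmul_linl (s := s.+1)).
by rewrite !tmulS IH [RHS]tE_ractE.
Qed.

Lemma tcast_id i (e : i = i) x : tcast e x = x.
Proof. by rewrite (eq_irrelevance e erefl). Qed.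

Lemma tcast_linear i j (e : i = j) : linear (tcast e).
Proof. by case: j / e. Qed.

Lemma tcastS i j (e : i = j) (e' : i.+1 = j.+1) m (x : tpow i) :
  tcast e' (tE m x : tpow i.+1) = tE m (tcast e x).
Proof. by case: j / e e' => e'; rewrite !tcast_id. Qed.

Lemma tmulA s t r (x : tpow s) (y : tpow t) (z : tpow r) (e : _ = _) :
  tcast e (tmul x (tmul y z)) = tmul (tmul x y) z.
Proof.
elim: s x e => [|s IH] x e; first by rewrite tcast_id /= tmul_lact.
move: x; apply: (@tensE_ext _ _ M (tpow s)) => [||m x].
- apply: (linear_comp (f := tcast e)); first exact: tcast_linear.
  exact: (tmul_linl (s := s.+1)).
- apply: (linear_comp (f := fun w : tpow (s.+1 + t) => tmul w z)).
    exact: (tmul_linl (s := (s + t).+1)).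
  exact: (tmul_linl (s := s.+1)).
by rewrite !tmulS (tcastS (addnA s t r)) IH.
Qed.

Lemma tmul0 s (x : tpow s) (a : E) (e : _ = _) :
  tcast e (tmul x (a : tpow 0)) = ract x a.
Proof.
elim: s x e => [|s IH] x e; first by rewrite tcast_id.
move: x; apply: (@tensE_ext _ _ M (tpow s)) => [||m x].
- apply: (linear_comp (f := tcast e)); first exact: tcast_linear.
  exact: (tmul_linl (s := s.+1)).
- exact: (@ract_linl _ _ (tpow s.+1)).
by rewrite tmulS (tcastS (addn0 s)) IH [RHS]tE_ractE.
Qed.

Definition tto k i (x : tpow k) : tpow i :=
  if k =P i is ReflectT e then tcast e x else 0.

Lemma tto_id k i (e : k = i) (x : tpow k) : tto i x = tcast e x.
Proof.
by case: i / e; rewrite /tto; case: eqP => // e; rewrite !tcast_id.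
Qed.
Lemma tto_ne k i (x : tpow k) : k != i -> tto i x = 0.
Proof. by rewrite /tto; case: eqP. Qed.
Lemma tto_refl k (x : tpow k) : tto k x = x.
Proof. by rewrite (tto_id erefl). Qed.
Lemma tto_cast i j k (e : i = j) (x : tpow i) : tto k (tcast e x) = tto k x.
Proof. by case: j / e. Qed.

Lemma tto_linear k i : linear (@tto k i).
Proof.
move=> a x y; rewrite /tto; case: eqP => [e|_]; first exact: tcast_linear.
by rewrite scaler0 addr0.
Qed.

Lemma lin_sum (U V : lmodType F) (f : U -> V) I (r : seq I) (P : pred I) g :
  linear f -> f (\sum_(i <- r | P i) g i) = \sum_(i <- r | P i) f (g i).
Proof.
move=> fl; pose fL : {linear U -> V} := HB.pack f
  (GRing.isSemilinear.Build F U V _ f (GRing.semilinear_linear fl)).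
by rewrite -[f]/(fL : U -> V) linear_sum.
Qed.

Lemma lin0 (U V : lmodType F) (f : U -> V) : linear f -> f 0 = 0.
Proof.
move=> fl; pose fL : {linear U -> V} := HB.pack f
  (GRing.isSemilinear.Build F U V _ f (GRing.semilinear_linear fl)).
by rewrite -[f]/(fL : U -> V) linear0.
Qed.

(* F_E(M) = prod_i M^{(x) i} *)
Definition ctens : Type := forall i, tpow i.

HB.instance Definition _ := gen_eqMixin ctens.
HB.instance Definition _ := gen_choiceMixin ctens.

Lemma ctensP (f g : ctens) : (forall i, f i = g i) -> f = g.
Proof. exact: functional_extensionality_dep. Qed.

Definition fadd (f g : ctens) : ctens := fun i => f i + g i.
Definition fopp (f : ctens) : ctens := fun i => - f i.
Definition fzero : ctens := fun i => 0.
Definition fscale (a : F) (f : ctens) : ctens := fun i => a *: f i.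

Fact faddA : associative fadd.
Proof. by move=> f g h; apply: ctensP => i; apply: addrA. Qed.
Fact faddC : commutative fadd.
Proof. by move=> f g; apply: ctensP => i; apply: addrC. Qed.
Fact fadd0 : left_id fzero fadd.
Proof. by move=> f; apply: ctensP => i; apply: add0r. Qed.
Fact faddN : left_inverse fzero fopp fadd.
Proof. by move=> f; apply: ctensP => i; apply: addNr. Qed.
HB.instance Definition _ :=
  GRing.isZmodule.Build ctens faddA faddC fadd0 faddN.

Fact fscaleA a b f : fscale a (fscale b f) = fscale (a * b) f.
Proof. by apply: ctensP => i; apply: scalerA. Qed.
Fact fscale1 : left_id 1 fscale.
Proof. by move=> f; apply: ctensP => i; apply: scale1r. Qed.
Fact fscaleDr : right_distributive fscale +%R.
Proof. by move=> a f g; apply: ctensP => i; apply: scalerDr. Qed.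
Fact fscaleDl f : {morph fscale^~ f : a b / a + b}.
Proof. by move=> a b; apply: ctensP => i; apply: scalerDl. Qed.
HB.instance Definition _ := GRing.Zmodule_isLmodule.Build F ctens
  fscaleA fscale1 fscaleDr fscaleDl.

Lemma ctensD (f g : ctens) i : (f + g) i = f i + g i. Proof. by []. Qed.
Lemma ctensN (f : ctens) i : (- f) i = - f i. Proof. by []. Qed.
Lemma ctens0 i : (0 : ctens) i = 0. Proof. by []. Qed.
Lemma ctensZ a (f : ctens) i : (a *: f) i = a *: f i. Proof. by []. Qed.

Definition fmul (f g : ctens) : ctens := fun i =>
  \sum_(s < i.+1) tcast (subnKC (leq_ord s)) (tmul (f s) (g (i - s)%N)).

Definition iotaE (x : E) : ctens := fun i => if i is 0 then x else 0.

Definition fone : ctens := iotaE 1.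

Lemma fmulE K (f g : ctens) i : (i < K)%N ->
  fmul f g i = \sum_(s < K) \sum_(t < K) tto i (tmul (f s) (g t)).
Proof.
move=> iK; rewrite /fmul.
pose G s := \sum_(t < K) tto i (tmul (f s) (g t)).
transitivity (\sum_(s < i.+1) G s).
  apply: eq_bigr => s _; have sK : (i - s < K)%N by rewrite (leq_ltn_trans (leq_subr _ _)).
  rewrite /G (bigD1 (Ordinal sK)) //= big1 ?addr0.
    by rewrite -(tto_id (subnKC (leq_ord s))).
  move=> t nt; rewrite tto_ne //; apply: contraNneq nt => st.
  by apply/eqP/val_inj => /=; have := addKn s t; rewrite st.
rewrite (big_ord_widen _ G iK) [RHS](bigID (fun s : 'I_K => (s < i.+1)%N)) /=.
rewrite [X in _ = _ + X]big1 ?addr0 // => s; rewrite -leqNgt => si.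
apply: big1 => t _; apply: tto_ne; rewrite neq_ltn (leq_trans si) ?orbT //.
exact: leq_addr.
Qed.

Fact tto_mull K k t i (x : tpow k) (y : tpow t) : (i < K)%N ->
  \sum_(r < K) tto i (tmul (tto r x) y) = tto i (tmul x y).
Proof.
move=> iK; case: (ltnP k K) => kK.
  rewrite (bigD1 (Ordinal kK)) //= tto_refl big1 ?addr0 // => r rk.
  rewrite [tto r x]tto_ne; last by apply: contraNneq rk => kr; apply/eqP/val_inj.
  by rewrite (lin0 (tmul_linl y)) (lin0 (@tto_linear _ _)).
rewrite [RHS]tto_ne; last first.
  by rewrite neq_ltn (leq_trans iK) ?orbT // (leq_trans kK) ?leq_addr.
apply: big1 => r _; rewrite [tto r x]tto_ne.
  by rewrite (lin0 (tmul_linl y)) (lin0 (@tto_linear _ _)).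
by rewrite neq_ltn (leq_trans (ltn_ord r)) ?orbT.
Qed.

Fact tto_mulr K k t i (x : tpow k) (y : tpow t) : (i < K)%N ->
  \sum_(r < K) tto i (tmul x (tto r y)) = tto i (tmul x y).
Proof.
move=> iK; case: (ltnP t K) => kK.
  rewrite (bigD1 (Ordinal kK)) //= tto_refl big1 ?addr0 // => r rk.
  rewrite [tto r y]tto_ne; last by apply: contraNneq rk => kr; apply/eqP/val_inj.
  by rewrite (lin0 (tmul_linr x)) (lin0 (@tto_linear _ _)).
rewrite [RHS]tto_ne; last first.
  by rewrite neq_ltn (leq_trans iK) ?orbT // (leq_trans kK) ?leq_addl.
apply: big1 => r _; rewrite [tto r y]tto_ne.
  by rewrite (lin0 (tmul_linr x)) (lin0 (@tto_linear _ _)).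
by rewrite neq_ltn (leq_trans (ltn_ord r)) ?orbT.
Qed.

Fact fmulA : associative fmul.
Proof.
move=> f g h; apply: ctensP => i; pose K := i.+1.
rewrite !(@fmulE K) //.
transitivity (\sum_(s < K) \sum_(u < K) \sum_(t < K)
    tto i (tmul (tmul (f s) (g u)) (h t))).
  apply: eq_bigr => s _.
  transitivity (\sum_(r < K) \sum_(u < K) \sum_(t < K)
      tto i (tmul (f s) (tto r (tmul (g u) (h t))))).
    apply: eq_bigr => r _; rewrite (@fmulE K) ?ltn_ord //.
    rewrite (lin_sum _ _ _ (tmul_linr _)) (lin_sum _ _ _ (@tto_linear _ _)).
    apply: eq_bigr => u _.
    by rewrite (lin_sum _ _ _ (tmul_linr _)) (lin_sum _ _ _ (@tto_linear _ _)).
  rewrite exchange_big; apply: eq_bigr => u _.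
  rewrite exchange_big; apply: eq_bigr => t _ /=.
  by rewrite tto_mulr // -(tmulA _ _ _ (addnA s u t)) tto_cast.
symmetry.
transitivity (\sum_(r < K) \sum_(t < K) \sum_(s < K) \sum_(u < K)
    tto i (tmul (tto r (tmul (f s) (g u))) (h t))).
  apply: eq_bigr => r _; apply: eq_bigr => t _; rewrite (@fmulE K) ?ltn_ord //.
  rewrite (lin_sum _ _ _ (tmul_linl _)) (lin_sum _ _ _ (@tto_linear _ _)).
  apply: eq_bigr => u _.
  by rewrite (lin_sum _ _ _ (tmul_linl _)) (lin_sum _ _ _ (@tto_linear _ _)).
rewrite exchange_big /=.
transitivity (\sum_(t < K) \sum_(s < K) \sum_(u < K)
    tto i (tmul (tmul (f s) (g u)) (h t))).
  apply: eq_bigr => t _; rewrite exchange_big; apply: eq_bigr => s _.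
  rewrite exchange_big; apply: eq_bigr => u _ /=.
  by rewrite tto_mull.
rewrite exchange_big; apply: eq_bigr => s _.
by rewrite exchange_big.
Qed.

Lemma iotaE_mull x (f : ctens) i : fmul (iotaE x) f i = lact x (f i).
Proof.
rewrite (@fmulE i.+1) // (bigD1 ord0) //= [X in _ + X]big1 ?addr0.
  rewrite (bigD1 ord_max) //= tto_refl big1 ?addr0 // => t ti.
  by apply: tto_ne; apply: contraNneq ti => ti; apply/eqP/val_inj.
case=> [[|s] si] //= _; apply: big1 => t _.
by rewrite (lin0 (elift_linear _)) (lin0 (@tto_linear _ _)).
Qed.

Lemma iotaE_mulr x (f : ctens) i : fmul f (iotaE x) i = ract (f i) x.
Proof.
rewrite (@fmulE i.+1) // exchange_big (bigD1 ord0) //= [X in _ + X]big1 ?addr0.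
  rewrite (bigD1 ord_max) //= big1 ?addr0 => [|t ti].
    by rewrite (tto_id (addn0 i)) tmul0.
  apply: tto_ne; apply: contraNneq ti => ti; apply/eqP/val_inj => /=.
  by rewrite -[LHS]addn0.
case=> [[|s] si] //= _; apply: big1 => t _.
by rewrite (lin0 (tmul_linr _)) (lin0 (@tto_linear _ _)).
Qed.

Fact fmul1 : left_id fone fmul.
Proof. by move=> f; apply: ctensP => i; rewrite iotaE_mull lact1. Qed.
Fact fmulr1 : right_id fone fmul.
Proof. by move=> f; apply: ctensP => i; rewrite iotaE_mulr ract1. Qed.

Fact fmul_linl g : linear (fmul^~ g).
Proof.
move=> a f h; apply: ctensP => i.
rewrite ctensD ctensZ /fmul scaler_sumr -big_split.
by apply: eq_bigr => s _; rewrite /= ctensD ctensZ tmul_linl tcast_linear.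
Qed.
Fact fmul_linr f : linear (fmul f).
Proof.
move=> a g h; apply: ctensP => i.
rewrite ctensD ctensZ /fmul scaler_sumr -big_split.
by apply: eq_bigr => s _; rewrite /= ctensD ctensZ tmul_linr tcast_linear.
Qed.
Fact fmulDl : left_distributive fmul +%R.
Proof. by move=> f g h; have := fmul_linl h 1 f g; rewrite !scale1r. Qed.
Fact fmulDr : right_distributive fmul +%R.
Proof. by move=> f g h; have := fmul_linr f 1 g h; rewrite !scale1r. Qed.
Fact fone_neq0 : fone != 0.
Proof.
apply/eqP => /(congr1 (fun f : ctens => f 0)) /eqP.
by rewrite ctens0 /=; apply/negP; apply: (@oner_neq0 E).
Qed.
HB.instance Definition _ := GRing.Zmodule_isNzRing.Build ctens
  fmulA fmul1 fmulr1 fmulDl fmulDr fone_neq0.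

Fact fscaleAl a (f g : ctens) : a *: (f * g : ctens) = (a *: f : ctens) * g.
Proof.
by have := fmul_linl g a f 0; rewrite (lin0 (fmul_linl g)) !addr0 => /esym.
Qed.
HB.instance Definition _ := GRing.Lmodule_isLalgebra.Build F ctens fscaleAl.
Fact fscaleAr a (f g : ctens) : a *: (f * g : ctens) = f * (a *: g : ctens).
Proof.
by have := fmul_linr f a g 0; rewrite (lin0 (fmul_linr f)) !addr0 => /esym.
Qed.
HB.instance Definition _ := GRing.Lalgebra_isAlgebra.Build F ctens fscaleAr.

Definition iotaM (m : M) : ctens := fun i =>
  match i return tpow i with
  | 1 => tE m ((1 : E) : regbimod E)
  | _ => 0
  end.

Lemma iotaM_lact (x : E) m : iotaE x * iotaM m = iotaM (lact x m).
Proof.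
apply: ctensP => i; rewrite [LHS]iotaE_mull; case: i => [|[|i]].
- exact: lin0 (lact_linr x).
- exact: tE_lactE.
- exact: lin0 (lact_linr x).
Qed.

Lemma iotaM_ract (x : E) m : iotaM m * iotaE x = iotaM (ract m x).
Proof.
apply: ctensP => i; rewrite [LHS]iotaE_mulr; case: i => [|[|i]].
- exact: lin0 (ract_linl x).
- rewrite [LHS]tE_ractE [RHS]tE_bal; congr (tE m _).
  by rewrite [LHS]mul1r [RHS]mulr1.
- exact: lin0 (ract_linl x).
Qed.

End TensorPowers.

(* The left regular module of A is completely reducible. *)
Definition semisimple (F : fieldType) (A : falgType F) : Prop :=
  forall I : {vspace A}, (fullv * I <= I)%VS ->
  exists J : {vspace A},
    [/\ (fullv * J <= J)%VS, (I + J = fullv)%VS & (I :&: J = 0)%VS].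

Section Product.
Variables (F : fieldType) (E : falgType F) (n : nat) (E_ : 'I_n -> {aspace E}).

(* E = prod_i E_i, each factor being identified with its image in E; a        *)
(* {aspace E} is an algebra with its own unit [algid], not that of E.         *)
Definition is_product : Prop :=
  [/\ (\sum_i E_ i)%VS = fullv, directv (\sum_i E_ i)%VS
    & forall i j, i != j -> (E_ i * E_ j)%VS = 0%VS].

Definition factor_unit (i : 'I_n) : E := algid (E_ i).

End Product.

Section Potentials.
Variables (F : fieldType) (E : falgType F) (M : bimodType E).
Implicit Types (f g h P Q : ctens M) (S : set (ctens M)).

Definition nu h : nat :=
  if pselect (exists i, h i != 0) is left h_neq0 then ex_minn h_neq0 else 0.

Definition dist f g : rat := if f == g then 0 else 2%:R ^- nu (f - g).

(* The distance takes rational values, so rational radii suffice. *)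
Definition fclosure S : set (ctens M) :=
  fun f => forall r : rat, 0 < r -> exists2 g, S g & dist f g < r.

Definition Fge l : set (ctens M) := fun f => forall j, (j < l)%N -> f j = 0.

Definition two_sided_ideal S : Prop :=
  [/\ S 0, forall f g, S f -> S g -> S (f + g)
    & forall f g h, S g -> S (f * g * h)].

Definition subspace S : Prop :=
  S 0 /\ forall (a : F) f g, S f -> S g -> S (a *: f + g).

Definition closed_ideal (N : {vspace M}) : set (ctens M) :=
  fclosure (smallest two_sided_ideal (fun f => exists2 m, m \in N & f = iotaM m)).

(* [F_E(M), F_E(M)] *)
Definition commutators : set (ctens M) :=
  fclosure (smallest subspace (fun h => exists f g, h = f * g - g * f)).

(* F_E(X) inside F_E(M), for a sub-bimodule X of M: the image in M^{(x) i} of *)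
(* X^{(x) i}.                                                                 *)
Fixpoint subpow (X : {vspace M}) i : {vspace tpow M i} :=
  match i return {vspace tpow M i} with
  | 0 => fullv
  | i'.+1 => <<[seq tE m x | m <- vbasis X, x <- vbasis (subpow X i')]>>%VS
  end.

Definition subctens (X : {vspace M}) : set (ctens M) :=
  fun f => forall i, f i \in subpow X i.

Variables (n : nat) (e : 'I_n -> E).

Definition potential P : Prop := P = \sum_i iotaE M (e i) * P * iotaE M (e i).

Definition cyc_equiv P Q : Prop :=
  [/\ potential P, potential Q & commutators (P - Q)].

End Potentials.

Section Bimodules.
Variables (F : fieldType) (E : falgType F) (M : bimodType E).
Variables (n : nat) (e : 'I_n -> E).
Implicit Types (N X : {vspace M}) (U : seq M) (A : {set 'I_n * 'I_n}).

Definition sub_bimod X : Prop :=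
  forall (x : E) m, m \in X -> lact x m \in X /\ ract m x \in X.

(* e_i N e_j *)
Definition corner i j N : {vspace M} :=
  (linfun (fun m : M => ract (lact (e i) m) (e j)) @: N)%VS.

Lemma cornerP i j N m :
  m \in corner i j N <->
  exists2 m', m' \in N & m = ract (lact (e i) m') (e j).
Proof.
pose f (m : M) := ract (lact (e i) m) (e j).
have fl : linear f by move=> k x y; rewrite /f lact_linr ract_linl.
pose fL : {linear M -> M} := HB.pack f
  (GRing.isSemilinear.Build F M M _ f (GRing.semilinear_linear fl)).
have fE x : linfun f x = f x by rewrite -[f]/(fL : M -> M) lfunE.
split=> [/memv_imgP[m' Nm' ->]|[m' Nm' ->]]; first by exists m'; rewrite ?fE.
by rewrite -[ract _ _]fE memv_img.
Qed.

Definition acyclic : Prop := (\sum_i corner i i fullv)%VS = 0%VS.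

Definition directed_generators N U : Prop :=
  [/\ {subset U <= N},
      forall a, a \in U -> exists i j, a = ract (lact (e j) a) (e i)
    & forall X, sub_bimod X -> {subset U <= X} -> (N <= X)%VS].

Definition polarization N A : Prop :=
  (forall i j, (i, j) \in A -> corner i j N != 0%VS /\ (j, i) \notin A) /\
  (forall i j, corner i j N != 0%VS -> (i, j) \in A \/ (j, i) \in A).

Variables (N : {vspace M}) (U : seq M) (A : {set 'I_n * 'I_n}).
Variable hat : 'I_n -> 'I_n -> M -> M.

Definition Uij i j : seq M := [seq a <- U | a \in corner i j N].

(* N is 2-cycle complete with respect to U, as witnessed by the polarization  *)
(* A and the bijections [hat i j] from U(i,j) to U(j,i), for (i,j) in A.      *)
Definition two_cycle_complete : Prop :=
  polarization N A /\
  forall i j, (i, j) \in A ->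
    [/\ {in Uij i j, forall a, hat i j a \in Uij j i},
        {in Uij i j &, injective (hat i j)}
      & forall b, b \in Uij j i -> exists2 a, a \in Uij i j & hat i j a = b].

Definition QN : ctens M :=
  \sum_(p in A) \sum_(a <- Uij p.1 p.2) iotaM a * iotaM (hat p.1 p.2 a).

(* u_a lies in e_j F_E(M) e_i and v_{\hat a} in e_i F_E(M) e_j, for a in      *)
(* U(i,j): otherwise no bimodule morphism can map a to - v_{\hat a} and       *)
(* \hat a to - u_a.                                                           *)
Definition directed_coefs (u v : M -> ctens M) : Prop :=
  forall i j, (i, j) \in A -> forall a, a \in Uij i j ->
    u a = iotaE M (e j) * u a * iotaE M (e i) /\
    v (hat i j a) = iotaE M (e i) * v (hat i j a) * iotaE M (e j).

Definition uv_sum (u v : M -> ctens M) : ctens M :=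
  \sum_(p in A) \sum_(a <- Uij p.1 p.2)
    (iotaM a * u a + v (hat p.1 p.2 a) * iotaM (hat p.1 p.2 a)).

(* Only the values of rho on X matter. *)
Definition bimod_morphism_on X (rho : M -> ctens M) : Prop :=
  (forall k : F, {in X &, forall m m', rho (k *: m + m') = k *: rho m + rho m'})
  /\ forall x y : E, {in X, forall m,
        rho (ract (lact x m) y) = iotaE M x * rho m * iotaE M y}.

End Bimodules.

(* Main.v *)
Require Import Defs.
From HB Require Import structures.
From mathcomp Require Import all_boot all_order all_algebra.
From mathcomp Require Import falgebra boolp classical_sets.

Set Implicit Arguments.
Unset Strict Implicit.
Unset Printing Implicit Defensive.

Import GRing.Theory.
Local Open Scope ring_scope.

(** The degree-completed tensor algebra of M is complete for the filtration by
    order, so an automorphism that removes the N-part of P in one degree at a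
    time can be iterated and passed to the limit.

    Let retr be the endomorphism of the tensor algebra that kills N and is the
    identity on M'.  Writing R for the terms of degree at least 3, the defect
    R - retr R lies in the ideal of N; suppose it starts in degree l >= 3 and
    let w be its component of degree l, a sum of words each of which has a
    letter in N.  Since the generators in U span N as a bimodule, rotating every
    word until one of these generators comes first shows that w is a sum of
    terms a q_a modulo commutators, with q_a of degree l - 1
    ([cyc_reduces_retr]).  Multiplying q_a by idempotents on both sides changes
    nothing modulo commutators and makes q directed ([gen_sum_directed]), and
    splitting the generators with respect to the polarization turns the sum
    into one of the form sum (a u_a + v_b b), where b is the partner of a and
    u = v = q ([gen_sum_uv]).

    The hypothesis then gives a bimodule morphism rho with rho(a) = - v_b and
    rho(b) = - u_a, hence an automorphism phi extending m |-> m + rho(m)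
    ([dual_automorphism]).  On the quadratic part it acts by
      (a - v_b)(b - u_a) = a b - (a u_a + v_b b) + v_b u_a,
    which cancels w up to commutators, while every other new term has degree at
    least 2l - 2 > l ([stage_step]).  The composites of these automorphisms
    converge, since the k-th one is the identity modulo degree k + 1, and in the
    limit R is fixed by retr, that is, R lies in the tensor algebra of M'
    ([reduction_limit]).  A last harmless step replaces R by its diagonal part
    sum e_i R e_i, which is a potential cyclically equivalent to R. *)

(** * The filtration by order and its completeness *)

Section Filtration.
Variables (F : fieldType) (E : falgType F) (M : bimodType E).
Implicit Types (f g h : ctens M).

Lemma Fge0 f : Fge 0 f. Proof. by []. Qed.

Lemma FgeW k l f : (k <= l)%N -> Fge l f -> Fge k f.
Proof. by move=> kl Ff j jk; apply: Ff; apply: leq_trans kl. Qed.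

Lemma FgeD k f g : Fge k f -> Fge k g -> Fge k (f + g).
Proof. by move=> Ff Fg j jk; rewrite ctensD Ff // Fg // addr0. Qed.

Lemma FgeN k f : Fge k f -> Fge k (- f).
Proof. by move=> Ff j jk; rewrite ctensN Ff // oppr0. Qed.

Lemma FgeB k f g : Fge k f -> Fge k g -> Fge k (f - g).
Proof. by move=> Ff Fg; apply/FgeD/FgeN. Qed.

Lemma FgeBC k f g : Fge k (f - g) -> Fge k (g - f).
Proof. by move=> /FgeN; rewrite opprB. Qed.

Lemma FgeZ k a f : Fge k f -> Fge k (a *: f).
Proof. by move=> Ff j jk; rewrite ctensZ Ff // scaler0. Qed.

Lemma Fge_sum k I (r : seq I) (Q : pred I) (G : I -> ctens M) :
  (forall i, Q i -> Fge k (G i)) -> Fge k (\sum_(i <- r | Q i) G i).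
Proof. by move=> FG; elim/big_ind: _ => //; apply: FgeD. Qed.

Lemma FgeM k l f g : Fge k f -> Fge l g -> Fge (k + l) (f * g).
Proof.
move=> Ff Fg j jkl; apply: big1 => s _.
case: (ltnP s k) => ks.
  by rewrite Ff // (lin0 (tmul_linl _)) (lin0 (@tcast_linear _ _ _ _ _ _)).
rewrite Fg ?(lin0 (tmul_linr _)) ?(lin0 (@tcast_linear _ _ _ _ _ _)) //.
by rewrite ltn_subLR ?leq_ord // (leq_trans jkl) ?leq_add2r.
Qed.

Lemma FgeMl k f g : Fge k f -> Fge k (f * g).
Proof. by move=> Ff; rewrite -[k]addn0; apply: FgeM. Qed.

Lemma FgeMr k f g : Fge k g -> Fge k (f * g).
Proof. by move=> Fg; rewrite -[k]add0n; apply: FgeM. Qed.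

Lemma Fge_eq0 f : (forall k, Fge k f) -> f = 0.
Proof. by move=> Ff; apply: ctensP => i; rewrite (Ff i.+1). Qed.

Lemma Fge_iotaM (m : M) : Fge 1 (iotaM m). Proof. by case. Qed.

Lemma FgeBtrans k f g h : Fge k (f - g) -> Fge k (g - h) -> Fge k (f - h).
Proof. by move=> fg gh; rewrite -(subrKA g); apply: FgeD. Qed.

(** This is [tensE_ind] with its conclusion about the type [tpow M k.+1], so
    that later rewriting never meets the unfolded tensor product. *)
Lemma tpow_ind k (P : tpow M k.+1 -> Prop) : P 0 ->
  (forall a m (x : tpow M k) y, P y -> P (a *: (tE m x : tpow M k.+1) + y)) ->
  forall y, P y.
Proof. exact: tensE_ind. Qed.

(** The inclusion of the degree k component into the product of all tensor
    powers. *)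
Definition homog k (x : tpow M k) : ctens M := fun i => tto i x.

Lemma homog_linear k : linear (@homog k).
Proof. by move=> a x y; apply: ctensP => i; rewrite /homog tto_linear. Qed.

Lemma homogM s t (x : tpow M s) (y : tpow M t) :
  homog x * homog y = homog (tmul x y).
Proof.
apply: ctensP => i; rewrite -[LHS]/(fmul _ _ i) (@fmulE _ _ _ i.+1) //.
rewrite /homog -(@tto_mull _ _ _ i.+1) //; apply: eq_bigr => s' _.
exact: tto_mulr.
Qed.

Lemma homog0 (x : E) : homog (x : tpow M 0) = iotaE M x.
Proof. by apply: ctensP => -[|i]; rewrite /homog ?tto_refl ?tto_ne. Qed.

Lemma homogS k (m : M) (x : tpow M k) :
  homog (tE m x : tpow M k.+1) = iotaM m * homog x.
Proof.
have -> : iotaM m = homog (tE m ((1 : E) : regbimod E) : tpow M 1).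
  by apply: ctensP => -[|[|i]]; rewrite /homog ?tto_refl ?tto_ne.
by rewrite homogM tmulS /= lact1.
Qed.

Lemma Fge_homog k (x : tpow M k) : Fge k (homog x).
Proof. by move=> j jk; rewrite /homog tto_ne // gtn_eqF. Qed.

Lemma ctens_sum I (r : seq I) (Q : pred I) (G : I -> ctens M) i :
  (\sum_(j <- r | Q j) G j) i = \sum_(j <- r | Q j) G j i.
Proof. exact: (lin_sum (f := fun f : ctens M => f i)). Qed.

(** Finite sums of homogeneous elements are dense: an identity between
    order-preserving linear maps need only be checked on them. *)
Lemma homog_dense k f : Fge k (f - \sum_(i < k) homog (f i)).
Proof.
move=> j jk; rewrite ctensD ctensN ctens_sum (bigD1 (Ordinal jk)) //=.
rewrite /homog tto_refl big1 ?addr0 ?subrr // => i ij.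
by rewrite tto_ne //; apply: contraNneq ij => ij; apply/eqP/val_inj.
Qed.

(** The limit of a sequence whose term of index i + 1 already has the correct
    component of degree i. *)
Definition flim (s : nat -> ctens M) : ctens M := fun i => s i.+1 i.

(** Completeness. *)
Lemma Fge_flim (s : nat -> ctens M) : (forall k, Fge k (s k.+1 - s k)) ->
  forall k, Fge k (flim s - s k).
Proof.
move=> cs.
have ss d k : Fge k (s (k + d)%N - s k).
  elim: d => [|d IH]; first by rewrite addn0 subrr.
  rewrite addnS; apply: (FgeBtrans _ IH).
  exact: FgeW (leq_addr d k) (cs (k + d)%N).
move=> k i ik; rewrite ctensD ctensN /flim.
have /FgeBC/(_ i (ltnSn i)) := ss (k - i.+1)%N i.+1.
by rewrite subnKC.
Qed.

End Filtration.

(** * Continuous endomorphisms *)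

Section Continuity.
Variables (F : fieldType) (E : falgType F) (M : bimodType E).
Implicit Types (phi psi : {lrmorphism ctens M -> ctens M}).

Definition shifts d (phi : ctens M -> ctens M) :=
  forall i f, Fge i f -> Fge (i + d) (phi f - f).

Definition filtered (phi : ctens M -> ctens M) :=
  forall i f, Fge i f -> Fge i (phi f).

Lemma shifts_filtered d phi : shifts d phi -> filtered phi.
Proof.
move=> sh i f Ff; rewrite -(subrK f (phi f)); apply: FgeD => //.
by apply: FgeW (sh _ _ Ff); apply: leq_addr.
Qed.

Lemma shiftsW d d' (phi : ctens M -> ctens M) :
  (d <= d')%N -> shifts d' phi -> shifts d phi.
Proof. by move=> dd sh i f /sh; apply: FgeW; rewrite leq_add2l. Qed.

Lemma shifts_comp d phi psi : shifts d phi -> shifts d psi ->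
  shifts d (phi \o psi).
Proof.
move=> shf shp i f Ff; apply: (@FgeBtrans _ _ _ _ _ (psi f)); last exact: shp.
by apply/shf/(shifts_filtered shp).
Qed.

(** Since phi - id raises the order, each step of the iteration
    s |-> s + (h - phi s) gains one degree in the equation phi s = h, and an
    element of the kernel has arbitrarily large order. *)
Lemma shifts_bij phi : shifts 1 phi -> bijective phi.
Proof.
move=> sh.
pose s h := fix s k := if k is k'.+1 then s k' + (h - phi (s k')) else 0.
have Fs h k : Fge k (h - phi (s h k)).
  elim: k => [//|k IH] /=; rewrite linearD opprD addrA -addn1.
  by apply/FgeBC/sh.
have lim h : forall k, Fge k (flim (s h) - s h k).
  by apply: Fge_flim => k; rewrite /= addrC addKr.
exists (fun h => flim (s h)) => f; last first.
  apply/eqP; rewrite -subr_eq0; apply/eqP/Fge_eq0 => k.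
  apply: (@FgeBtrans _ _ _ _ _ (phi (s f k))); last exact/FgeBC.
  by rewrite -linearB; apply/(shifts_filtered sh)/lim.
apply/eqP; rewrite -subr_eq0; apply/eqP; set h := phi f.
(* The solution of phi x = phi f obtained by iteration differs from f by an
   element of the kernel. *)
have phi0 : phi (flim (s h) - f) = 0.
  apply/Fge_eq0 => k; rewrite linearB.
  apply: (@FgeBtrans _ _ _ _ _ (phi (s h k))).
    by rewrite -linearB; apply/(shifts_filtered sh)/lim.
  exact/FgeBC.
apply: Fge_eq0; elim=> [//|k /sh]; rewrite phi0 sub0r addn1 => /FgeN.
by rewrite opprK.
Qed.

(** The tensor algebra is topologically generated by E and M. *)
Lemma filtered_eq phi psi : filtered phi -> filtered psi ->
  (forall x, phi (iotaE M x) = psi (iotaE M x)) ->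
  (forall m, phi (iotaM m) = psi (iotaM m)) -> phi =1 psi.
Proof.
move=> cphi cpsi eqE eqM f.
have eqh k (x : tpow M k) : phi (homog x) = psi (homog x).
  elim: k x => [|k IH] x; first by rewrite homog0.
  elim/tpow_ind: x => [|a m x y IHy].
    by rewrite (lin0 (@homog_linear _ _ _ _)) !linear0.
  by rewrite homog_linear !linearP /= IHy homogS !rmorphM /= IH eqM.
apply/eqP; rewrite -subr_eq0; apply/eqP/Fge_eq0 => k.
have := @homog_dense _ _ _ k f; set t := \sum_(i < k) _ => Ft.
have Dt : phi t = psi t.
  by rewrite !linear_sum; apply: eq_bigr => i _; apply: eqh.
apply: (@FgeBtrans _ _ _ _ _ (phi t)); first by rewrite -linearB; apply: cphi.
by rewrite Dt -linearB; apply/cpsi/FgeBC.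
Qed.

(** A pointwise limit of algebra morphisms is one, because the difference of
    the two sides of each identity has arbitrarily large order. *)
Lemma lrmorphism_lim (psi : nat -> {lrmorphism ctens M -> ctens M}) :
  (forall k f, Fge k (psi k.+1 f - psi k f)) ->
  exists phi : {lrmorphism ctens M -> ctens M},
    forall k f, Fge k (phi f - psi k f).
Proof.
move=> cpsi; pose phi f := flim (psi^~ f).
have lim k f : Fge k (phi f - psi k f) by apply: Fge_flim => k'; apply: cpsi.
have phil : linear phi.
  move=> a f g; apply/eqP; rewrite -subr_eq0; apply/eqP/Fge_eq0 => k.
  apply: (FgeBtrans (lim k _)); rewrite linearP opprD addrACA -scalerBr.
  by apply: FgeD; [apply: FgeZ|]; apply/FgeBC.
have phiM f g : phi (f * g) = phi f * phi g.
  apply/eqP; rewrite -subr_eq0; apply/eqP/Fge_eq0 => k.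
  apply: (FgeBtrans (lim k _)); rewrite rmorphM.
  apply: (@FgeBtrans _ _ _ _ _ (phi f * psi k g)).
    by rewrite -mulrBl; apply/FgeMl/FgeBC.
  by rewrite -mulrBr; apply/FgeMr/FgeBC.
have phi1 : phi 1 = 1.
  apply/eqP; rewrite -subr_eq0; apply/eqP/Fge_eq0 => k.
  by have := lim k 1; rewrite rmorph1.
pose phiL : {lrmorphism ctens M -> ctens M} := HB.pack phi
  (GRing.isSemilinear.Build F _ _ _ phi (GRing.semilinear_linear phil))
  (GRing.isMonoidMorphism.Build _ _ phi (phi1, phiM)).
by exists phiL.
Qed.

End Continuity.

(** * Extending bimodule maps to algebra endomorphisms *)

Section Embeddings.
Variables (F : fieldType) (E : falgType F) (M : bimodType E).

Lemma iotaE_linear : linear (iotaE M).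
Proof.
move=> a x y; apply: ctensP => -[|i] //.
by rewrite ctensD ctensZ /= scaler0 addr0.
Qed.

Lemma iotaEM x y : iotaE M x * iotaE M y = iotaE M (x * y).
Proof.
apply: ctensP => i; rewrite [LHS]iotaE_mull.
by case: i => [//|i]; apply: lin0 (lact_linr x).
Qed.

Lemma iotaE1 : iotaE M 1 = 1. Proof. by []. Qed.

Lemma iotaM_linear : linear (@iotaM F E M).
Proof.
move=> a x y; apply: ctensP => -[|[|i]]; rewrite ctensD ctensZ /=.
- by rewrite scaler0 addr0.
- by case: (tE_bilin M (regbimod E)) => ->.
- by rewrite scaler0 addr0.
Qed.

Lemma iotaM_bimod : bimod_morphism_on fullv (@iotaM F E M).
Proof.
split=> [k x y _ _|x y m _]; first exact: iotaM_linear.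
by rewrite iotaM_lact iotaM_ract.
Qed.

End Embeddings.

Section Extension.
Variables (F : fieldType) (E : falgType F) (M : bimodType E).
Variable g : M -> ctens M.
Hypotheses (gB : bimod_morphism_on fullv g) (g1 : forall m, Fge 1 (g m)).

Let g_linear : linear g.
Proof. by move=> k x y; apply: (proj1 gB); rewrite memvf. Qed.

Let g_lact x m : g (lact x m) = iotaE M x * g m.
Proof. by have := proj2 gB x 1 m (memvf m); rewrite ract1 iotaE1 mulr1. Qed.

Let g_ract m y : g (ract m y) = g m * iotaE M y.
Proof. by have := proj2 gB 1 y m (memvf m); rewrite lact1 iotaE1 mul1r. Qed.

(** m_1 (x) ... (x) m_i goes to the product g m_1 * ... * g m_i. *)
Fixpoint extpow i : tpow M i -> ctens M :=
  match i return tpow M i -> ctens M with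
  | 0 => fun x => iotaE M x
  | i'.+1 => fun x => elift (fun m x' => g m * extpow x') x
  end.

Lemma extpow_linear i : linear (@extpow i).
Proof. by case: i => [|i]; [apply: iotaE_linear | apply: elift_linear]. Qed.

Let extpow_bilin i : bilin (fun m (x : tpow M i) => g m * extpow x).
Proof.
split=> [x|m] k u v; first by rewrite g_linear mulrDl scalerAl.
by rewrite extpow_linear mulrDr scalerAr.
Qed.

Lemma extpow_lact i x (t : tpow M i) : extpow (lact x t) = iotaE M x * extpow t.
Proof.
elim: i x t => [|i IH] x t; first by rewrite /= iotaEM.
elim/tpow_ind: t => [|a m u t IHt].
  by rewrite (lin0 (lact_linr x)) (lin0 (@extpow_linear _)) mulr0.
rewrite lact_linr !extpow_linear IHt mulrDr -scalerAr; congr (_ *: _ + _).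
rewrite [lact x _]tE_lactE /= !eliftE ?g_lact ?mulrA //;
  by move=> m' y u'; rewrite g_ract IH mulrA.
Qed.

Lemma extpowS i m (x : tpow M i) :
  extpow (tE m x : tpow M i.+1) = g m * extpow x.
Proof.
by rewrite /= eliftE // => m' y u; rewrite g_ract extpow_lact mulrA.
Qed.

Lemma extpowM s t (x : tpow M s) (y : tpow M t) :
  extpow x * extpow y = extpow (tmul x y).
Proof.
elim: s x => [|s IH] x; first by rewrite /= extpow_lact.
elim/tpow_ind: x => [|a m u x IHx].
  by rewrite (lin0 (tmul_linl y)) !(lin0 (@extpow_linear _)) mul0r.
rewrite tmul_linl !extpow_linear mulrDl IHx -scalerAl; congr (_ *: _ + _).
by rewrite tmulS !extpowS -mulrA IH.
Qed.

Lemma Fge_extpow i (x : tpow M i) : Fge i (extpow x).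
Proof.
elim: i x => [//|i IH] x; elim/tpow_ind: x => [|a m u x IHx].
  by rewrite (lin0 (@extpow_linear _)).
rewrite extpow_linear; apply: FgeD IHx; apply: FgeZ.
by rewrite extpowS -add1n; apply: FgeM.
Qed.

(** The sum of the images of all components of f converges because g has values
    of positive order; components of degree above d do not contribute in
    degree d. *)
Definition ext_fun (f : ctens M) : ctens M :=
  fun d => (\sum_(i < d.+1) extpow (f i)) d.

Lemma Fge_ext_fun k f : Fge k (ext_fun f - \sum_(i < k) extpow (f i)).
Proof.
move=> d dk; rewrite ctensD ctensN /ext_fun !ctens_sum.
rewrite (big_ord_widen _ (fun i => extpow (f i) d) dk).
rewrite [X in _ - X](bigID (fun i : 'I_k => (i < d.+1)%N)) /=.
rewrite [X in _ - (_ + X)]big1 ?addr0 ?subrr // => i.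
by rewrite -ltnNge => di; apply: Fge_extpow.
Qed.

Lemma ext_fun_linear : linear ext_fun.
Proof.
move=> a f h; apply: ctensP => d; rewrite ctensD ctensZ /ext_fun !ctens_sum.
rewrite scaler_sumr -big_split; apply: eq_bigr => i _ /=.
by rewrite ctensD ctensZ extpow_linear.
Qed.

Lemma ext_fun_filtered : filtered ext_fun.
Proof.
move=> i f Ff; rewrite -(subr0 (ext_fun f)).
have <- : \sum_(j < i) extpow (f j) = 0; last exact: Fge_ext_fun.
by apply: big1 => j _; rewrite Ff // (lin0 (@extpow_linear _)).
Qed.

Lemma ext_fun_homog i (x : tpow M i) : ext_fun (homog x) = extpow x.
Proof.
apply/eqP; rewrite -subr_eq0; apply/eqP/Fge_eq0 => k.
apply: (@FgeW _ _ _ k (maxn k i.+1)); first exact: leq_maxl.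
apply: (FgeBtrans (@Fge_ext_fun _ _)).
have ik : (i < maxn k i.+1)%N by rewrite leq_max ltnSn orbT.
rewrite (bigD1 (Ordinal ik)) //= /homog tto_refl big1 ?addr0 ?subrr //.
move=> j ij; rewrite tto_ne ?(lin0 (@extpow_linear _)) //.
by apply: contraNneq ij => ij; apply/eqP/val_inj.
Qed.

(** Both sides are continuous in f and in h, so that homogeneous factors
    suffice, and for these the claim is [extpowM]. *)
Lemma ext_funM : {morph ext_fun : f h / f * h}.
Proof.
move=> f h; apply/eqP; rewrite -subr_eq0; apply/eqP/Fge_eq0 => k.
have := @homog_dense _ _ _ k f; set f' := \sum_(i < k) _ => ff'.
have := @homog_dense _ _ _ k h; set h' := \sum_(i < k) _ => hh'.
have cB u v : Fge k (u - v) -> Fge k (ext_fun u - ext_fun v).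
  move=> /ext_fun_filtered.
  by rewrite addrC -scaleN1r ext_fun_linear scaleN1r addrC.
have cM u u' v v' : Fge k (u - u') -> Fge k (v - v') -> Fge k (u * v - u' * v').
  move=> uu vv; apply: (@FgeBtrans _ _ _ _ _ (u' * v)).
    by rewrite -mulrBl; apply: FgeMl.
  by rewrite -mulrBr; apply: FgeMr.
apply: (@FgeBtrans _ _ _ _ _ (ext_fun (f' * h'))); first exact/cB/cM.
suff -> : ext_fun (f' * h') = ext_fun f' * ext_fun h'.
  by apply/cM; apply/cB/FgeBC.
rewrite /f' /h' mulr_suml !(lin_sum _ _ _ ext_fun_linear) mulr_suml.
apply: eq_bigr => i _.
rewrite !mulr_sumr !(lin_sum _ _ _ ext_fun_linear) ?mulr_sumr.
apply: eq_bigr => j _.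
by rewrite homogM !ext_fun_homog extpowM.
Qed.

Lemma ext_fun_iotaE x : ext_fun (iotaE M x) = iotaE M x.
Proof. by rewrite -homog0 ext_fun_homog /= homog0. Qed.

Lemma ext_fun_iotaM m : ext_fun (iotaM m) = g m.
Proof.
have /(congr1 ext_fun) := homogS m ((1 : E) : tpow M 0).
by rewrite homog0 iotaE1 mulr1 ext_fun_homog extpowS mulr1.
Qed.

Lemma ext_fun1 : ext_fun 1 = 1.
Proof. exact: ext_fun_iotaE. Qed.

(** The universal property of the tensor algebra.  The morphism is hidden behind
    an opaque proof to prevent simplification from unfolding it. *)
Fact ext_key : {phi : {lrmorphism ctens M -> ctens M} | phi =1 ext_fun}.
Proof.
pose phi : {lrmorphism ctens M -> ctens M} := HB.pack ext_fun
  (GRing.isSemilinear.Build F _ _ _ ext_fun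
    (GRing.semilinear_linear ext_fun_linear))
  (GRing.isMonoidMorphism.Build _ _ ext_fun (ext_fun1, ext_funM)).
by exists phi.
Qed.

Definition ext : {lrmorphism ctens M -> ctens M} := sval ext_key.

Lemma extE : ext =1 ext_fun. Proof. exact: (svalP ext_key). Qed.

Lemma ext_filtered : filtered ext.
Proof. by move=> i f Ff; rewrite extE; apply: ext_fun_filtered. Qed.

Lemma ext_iotaE x : ext (iotaE M x) = iotaE M x.
Proof. by rewrite extE ext_fun_iotaE. Qed.

Lemma ext_iotaM m : ext (iotaM m) = g m.
Proof. by rewrite extE ext_fun_iotaM. Qed.

(** Moving each letter m of a word by terms of degree at least d + 1 moves the
    word by terms of degree at least d higher: replace the letters one by
    one. *)
Lemma ext_shifts d : (forall m, Fge d.+1 (g m - iotaM m)) -> shifts d ext.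
Proof.
move=> gd.
have sh i (x : tpow M i) : Fge (i + d) (extpow x - homog x).
  elim: i x => [|i IH] x; first by rewrite homog0 /= subrr.
  elim/tpow_ind: x => [|a m u x IHx].
    by rewrite (lin0 (@extpow_linear _)) (lin0 (@homog_linear _ _ _ _)) subrr.
  rewrite extpow_linear homog_linear opprD addrACA -scalerBr.
  apply: FgeD IHx; apply: FgeZ; rewrite extpowS homogS.
  rewrite -[X in Fge X](addnC d) addnS -addSn.
  apply: (@FgeBtrans _ _ _ _ _ (iotaM m * extpow u)).
    by rewrite -mulrBl; apply: FgeM => //; apply: Fge_extpow.
  rewrite -mulrBr addSnnS addnC -add1n -addnA.
  by apply: FgeM => //; apply: Fge_iotaM.
move=> i f Ff.
have := @homog_dense _ _ _ (i + d)%N f; set f' := \sum_(j < _) _ => ff'.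
rewrite -[f in ext f](subrK f') linearD -addrA.
apply: FgeD; first exact: ext_filtered.
apply: (@FgeBtrans _ _ _ _ _ f'); last exact/FgeBC.
rewrite /f' linear_sum -sumrB; apply: Fge_sum => j _.
case: (ltnP j i) => ji.
  by rewrite Ff // (lin0 (@homog_linear _ _ _ _)) linear0 subrr.
rewrite /= extE ext_fun_homog; apply: FgeW (sh _ _).
by rewrite leq_add2r.
Qed.

End Extension.

(** * Closures and commutators *)

Section Closure.
Variables (F : fieldType) (E : falgType F) (M : bimodType E).
Implicit Types (f g h : ctens M) (S : set (ctens M)).

Lemma Fge_nu k h : h != 0 -> Fge k h <-> (k <= nu h)%N.
Proof.
move=> h0; have nz : exists i, h i != 0.
  apply: contrapT => hz; case/eqP: h0; apply: ctensP => i.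
  by apply/eqP/negPn/negP => hi; apply: hz; exists i.
rewrite /nu; case: pselect => // e; case: ex_minnP => m hm min_m.
split=> [Fh|km j jk]; first by rewrite leqNgt; apply: contraNN hm => /Fh ->.
by apply/eqP/negPn/negP => /min_m; rewrite leqNgt (leq_trans jk km).
Qed.

(** The metric induces the topology of the filtration by order, so that
    distances can be replaced by orders from here on. *)
Lemma fclosureP S f :
  Defs.fclosure S f <-> forall k, exists2 g, S g & Fge k (f - g).
Proof.
have two k : 0 < 2%:R ^+ k :> rat by rewrite Num.Theory.exprn_gt0.
split=> [Sf k | Sf r r0].
  have [|g Sg d] := Sf (2%:R ^- k); first by rewrite Num.Theory.invr_gt0.
  exists g => //; move: d; rewrite /dist; have [->|fg] := eqVneq f g.
    by rewrite subrr.
  rewrite Num.Theory.ltf_pV2 ?Num.Theory.posrE //.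
  rewrite Num.Theory.ltr_eXn2l // => kn.
  by apply/Fge_nu; [rewrite subr_eq0 | apply: ltnW].
have [g Sg fg] := Sf (Num.bound r^-1).
exists g => //; rewrite /dist; case: eqVneq => [//|ne].
have rb : r^-1 < 2%:R ^+ Num.bound r^-1.
  by apply: Num.Theory.upper_nthrootP.
rewrite -[r]invrK Num.Theory.ltf_pV2 ?Num.Theory.posrE ?Num.Theory.invr_gt0 //.
apply: (Order.POrderTheory.lt_le_trans rb).
rewrite Num.Theory.ler_eXn2l //.
by apply/Fge_nu; rewrite ?subr_eq0.
Qed.

Lemma sub_fclosure S f : S f -> Defs.fclosure S f.
Proof. by move=> Sf; apply/fclosureP => k; exists f; rewrite ?subrr. Qed.

Let comm_span :=
  smallest (@subspace F E M) (fun h => exists f g, h = f * g - g * f).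

Let comm_span_subspace : subspace comm_span.
Proof.
split=> [X [[X0 _] _] //|a f g Xf Xg X SX].
by have [[_ XD] _] := SX; apply: XD; [apply: Xf | apply: Xg].
Qed.

Lemma commutatorsP f :
  commutators f <-> forall k, exists2 g, comm_span g & Fge k (f - g).
Proof. exact: fclosureP. Qed.

Lemma commutators_comm f g : commutators (f * g - g * f).
Proof. by apply: sub_fclosure => X [_ subX]; apply: subX; exists f, g. Qed.

Lemma commutators0 : commutators (0 : ctens M).
Proof. by rewrite -(subrr (0 * 0)); apply: commutators_comm. Qed.

Lemma commutators_linear a f g :
  commutators f -> commutators g -> commutators (a *: f + g).
Proof.
move=> /commutatorsP Cf /commutatorsP Cg; apply/commutatorsP => k.
have [[f' Sf ff] [g' Sg gg]] := (Cf k, Cg k).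
exists (a *: f' + g'); first by apply: (proj2 comm_span_subspace).
by rewrite opprD addrACA -scalerBr; apply: FgeD => //; apply: FgeZ.
Qed.

Lemma commutatorsD f g :
  commutators f -> commutators g -> commutators (f + g).
Proof. by move=> Cf Cg; rewrite -[f]scale1r; apply: commutators_linear. Qed.

Lemma commutators_sum I (r : seq I) (Q : pred I) (G : I -> ctens M) :
  (forall i, Q i -> commutators (G i)) -> commutators (\sum_(i <- r | Q i) G i).
Proof.
move=> CG; elim/big_ind: _ => //; [exact: commutators0 | exact: commutatorsD].
Qed.

Lemma commutators_lim f :
  (forall k, exists2 g, commutators g & Fge k (f - g)) -> commutators f.
Proof.
move=> Cf; apply/commutatorsP => k.
have [g /commutatorsP/(_ k)[h Sh gh] fg] := Cf k.
by exists h => //; apply: (FgeBtrans fg).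
Qed.

Lemma commutators_morph (phi : {lrmorphism ctens M -> ctens M}) f :
  filtered phi -> commutators f -> commutators (phi f).
Proof.
move=> cphi /commutatorsP Cf; apply: commutators_lim => k.
have [g Sg fg] := Cf k; exists (phi g); last by rewrite -linearB; apply: cphi.
apply: (Sg (fun h => commutators (phi h))); split.
  split; first by rewrite linear0; apply: commutators0.
  by move=> a u v Cu Cv; rewrite linearP; apply: commutators_linear.
by move=> _ [u [v ->]]; rewrite linearB !rmorphM; apply: commutators_comm.
Qed.

End Closure.

(** * Potentials and the idempotents of the factors *)

Section Idempotents.
Variables (F : fieldType) (E : falgType F) (n : nat) (E_ : 'I_n -> {aspace E}).
Hypothesis prodE : is_product E_.
Local Notation e := (factor_unit E_).

Lemma factor_unitM i j : e i * e j = if i == j then e i else 0.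
Proof.
case: prodE => _ _ orth; case: eqVneq => [->|ij].
  by rewrite algidl // memv_algid.
by apply/eqP; rewrite -memv0 -(orth i j ij) memv_mul ?memv_algid.
Qed.

(** Decompose 1 = sum x_j with x_j in E_j: each e_j fixes x_j and kills the
    other terms, so that the sum of the e_j acts as the identity on 1. *)
Lemma sum_factor_unit : \sum_i e i = 1.
Proof.
have [sumE _ orth] := prodE.
have : 1 \in (\sum_i E_ i)%VS by rewrite sumE memvf.
case/memv_sumP => x Ex D1; rewrite -[LHS]mulr1 D1 mulr_sumr.
apply: eq_bigr => j _; rewrite mulr_suml (bigD1 j) //= big1 ?addr0.
  by rewrite algidl ?Ex.
move=> i ij; apply/eqP; rewrite -memv0 -(orth i j ij) memv_mul ?memv_algid //.
exact: Ex.
Qed.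

Variable M : bimodType E.
Implicit Types f : ctens M.
Local Notation idem i := (iotaE M (e i)).

Lemma idemM i j : idem i * idem j = if i == j then idem i else 0.
Proof.
rewrite iotaEM factor_unitM; case: ifP => // _.
exact: lin0 (@iotaE_linear _ _ _).
Qed.

Definition diag_part f : ctens M := \sum_i idem i * f * idem i.

Lemma diag_part_idem i f :
  diag_part (idem i * f * idem i) = idem i * f * idem i.
Proof.
rewrite /diag_part (bigD1 i) //= big1 ?addr0 => [|j ji].
  by rewrite !mulrA idemM eqxx -!mulrA idemM eqxx.
by rewrite !mulrA idemM (negPf ji) !mul0r.
Qed.

Lemma diag_part_linear : linear diag_part.
Proof.
move=> a f g; rewrite /diag_part scaler_sumr -big_split.
apply: eq_bigr => i _ /=.
by rewrite mulrDr mulrDl -scalerAr -scalerAl.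
Qed.

Lemma potential_diag_part f : potential e (diag_part f).
Proof.
rewrite /potential -[RHS]/(diag_part _) /diag_part -[RHS]/(diag_part _).
rewrite (lin_sum _ _ _ diag_part_linear); apply: eq_bigr => i _.
by rewrite diag_part_idem.
Qed.

(** Membership in the corner e_i F_E(M) e_j. *)
Definition supported i j f := f = idem i * f * idem j.

Lemma supported_idem i j f : supported i j (idem i * f * idem j).
Proof. by rewrite /supported !mulrA idemM eqxx -!mulrA idemM eqxx. Qed.

Lemma supportedM i k j f g :
  supported i k f -> supported k j g -> supported i j (f * g).
Proof.
move=> Df Dg; rewrite /supported mulrA.
have -> : idem i * f = f by rewrite Df !mulrA idemM eqxx.
by rewrite -mulrA; congr (f * _); rewrite Dg -!mulrA idemM eqxx.
Qed.

Lemma potential_supported i f : supported i i f -> potential e f.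
Proof. by move=> ->; apply: esym; apply: diag_part_idem. Qed.

Lemma potentialD f g : potential e f -> potential e g -> potential e (f + g).
Proof.
rewrite /potential -!/(diag_part _) => {1}-> {1}->.
by have := diag_part_linear 1 f g; rewrite !scale1r.
Qed.

Lemma potential_sum I (r : seq I) (Q : pred I) (G : I -> ctens M) :
  (forall i, Q i -> potential e (G i)) -> potential e (\sum_(i <- r | Q i) G i).
Proof.
move=> pG; elim/big_ind: _ => //; last exact: potentialD.
by apply: esym; apply: (lin0 diag_part_linear).
Qed.

(** f = sum f e_i, and f e_i - e_i f e_i is the commutator of f e_i and e_i. *)
Lemma diag_part_cyc f : commutators (f - diag_part f).
Proof.
rewrite -[f in f - _]mulr1 -(iotaE1 M) -sum_factor_unit.
rewrite (lin_sum _ _ _ (@iotaE_linear _ _ _)) mulr_sumr /diag_part -sumrB.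
apply: commutators_sum => i _.
have -> : f * idem i = f * idem i * idem i by rewrite -mulrA idemM eqxx.
by rewrite -[X in _ - X]mulrA; apply: commutators_comm.
Qed.

End Idempotents.

(** * The retraction onto the tensor algebra of a direct summand *)

Section Span.
Variables (F : fieldType) (V : vectType F).

Lemma span_ind (s : seq V) (P : V -> Prop) : P 0 ->
  (forall k u v, u \in s -> P v -> P (k *: u + v)) ->
  forall m, m \in <<s>>%VS -> P m.
Proof.
move=> P0 PD m sm; rewrite (coord_span (X := in_tuple s) sm).
elim/big_rec: _ => // i v _; apply: PD.
by rewrite -tnth_nth mem_tnth.
Qed.

Lemma span_lin (W : vectType F) (f : V -> W) (s : seq V) (X : {vspace W}) :
  linear f -> (forall u, u \in s -> f u \in X) ->
  forall m, m \in <<s>>%VS -> f m \in X.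
Proof.
move=> fl fX; apply: span_ind; first by rewrite (lin0 fl) mem0v.
by move=> k u v su Xv; rewrite fl; apply: rpredD => //; apply/rpredZ/fX.
Qed.

End Span.

Section Projections.
Variables (F : fieldType) (E : falgType F) (M : bimodType E).
Variables (X Y : {vspace M}).
Hypotheses (bX : sub_bimod X) (bY : sub_bimod Y).
Hypotheses (XY1 : (X + Y)%VS = fullv) (XY0 : (X :&: Y)%VS = 0%VS).

Lemma daddv_pi_ker m : m \in Y -> daddv_pi X Y m = 0.
Proof.
move=> Ym; have := @daddv_pi_add _ _ X Y m XY0.
rewrite XY1 memvf => /(_ isT); rewrite [daddv_pi Y X m]daddv_pi_id //.
  by rewrite -[RHS]add0r => /addIr.
by rewrite capvC.
Qed.

Lemma daddv_pi_bimod x m y :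
  daddv_pi X Y (ract (lact x m) y) = ract (lact x (daddv_pi X Y m)) y.
Proof.
have := @daddv_pi_add _ _ X Y m XY0; rewrite XY1 memvf => /(_ isT) Dm.
have lD (u v : M) :
    ract (lact x (u + v)) y = ract (lact x u) y + ract (lact x v) y.
  have := lact_linr x 1 u v; have := ract_linl y 1 (lact x u) (lact x v).
  by rewrite !scale1r => rl ->.
have mX (Z : {vspace M}) u : sub_bimod Z -> u \in Z -> ract (lact x u) y \in Z.
  by move=> bZ Zu; case: (bZ y (lact x u)) => //; case: (bZ x u).
have Xm := mX X _ bX (memv_pi X Y m).
have Ym := mX Y _ bY (memv_pi Y X m).
rewrite -[m in LHS]Dm lD linearD /=.
by rewrite (daddv_pi_id XY0 Xm) (daddv_pi_ker Ym) addr0.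
Qed.

Lemma extend_bimod (rho : M -> ctens M) : bimod_morphism_on X rho ->
  bimod_morphism_on fullv (rho \o daddv_pi X Y).
Proof.
move=> [rhoD rhoB]; split=> [k u v _ _|x y m _] /=.
  by rewrite linearP rhoD ?memv_pi.
by rewrite daddv_pi_bimod rhoB ?memv_pi.
Qed.

End Projections.

Lemma bimod_morphism_onD (F : fieldType) (E : falgType F) (M : bimodType E)
    (X : {vspace M}) (f g : M -> ctens M) :
  bimod_morphism_on X f -> bimod_morphism_on X g ->
  bimod_morphism_on X (fun m => f m + g m).
Proof.
move=> [fD fB] [gD gB]; split=> [k u v Xu Xv|x y m Xm].
  by rewrite fD ?gD // scalerDr addrACA.
by rewrite fB ?gB // mulrDr mulrDl.
Qed.

Lemma bimod_morphism_onS (F : fieldType) (E : falgType F) (M : bimodType E)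
    (X Y : {vspace M}) (f : M -> ctens M) :
  (X <= Y)%VS -> bimod_morphism_on Y f -> bimod_morphism_on X f.
Proof.
move=> /subvP sXY [fD fB]; split=> [k u v Xu Xv|x y m Xm].
  by apply: fD; apply: sXY.
by apply: fB; apply: sXY.
Qed.

(** [retr] is the endomorphism that kills N and fixes M'; its image is the
    tensor algebra of M'. *)
Section Retraction.
Variables (F : fieldType) (E : falgType F) (M : bimodType E).
Variables (N M' : {vspace M}).
Hypotheses (bN : sub_bimod N) (bM' : sub_bimod M').
Hypotheses (NM1 : (N + M')%VS = fullv) (NM0 : (N :&: M')%VS = 0%VS).

Definition retr_gen : M -> ctens M := @iotaM F E M \o daddv_pi M' N.

Lemma retr_gen_bimod : bimod_morphism_on fullv retr_gen.
Proof.
apply: extend_bimod; rewrite // 1?addvC 1?capvC //.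
exact: bimod_morphism_onS (subvf M') (@iotaM_bimod F E M).
Qed.

Lemma Fge_retr_gen m : Fge 1 (retr_gen m). Proof. exact: Fge_iotaM. Qed.

Definition retr := ext retr_gen_bimod Fge_retr_gen.

Lemma retr_filtered : filtered retr. Proof. exact: ext_filtered. Qed.

Lemma retr_iotaE x : retr (iotaE M x) = iotaE M x.
Proof. exact: ext_iotaE. Qed.

Lemma retr_iotaM m : retr (iotaM m) = iotaM (daddv_pi M' N m).
Proof. exact: ext_iotaM. Qed.

Lemma retr_iotaM_id m : m \in M' -> retr (iotaM m) = iotaM m.
Proof. by move=> M'm; rewrite retr_iotaM daddv_pi_id // capvC. Qed.

Lemma morph_retr (phi : {lrmorphism ctens M -> ctens M}) :
  filtered phi -> (forall x, phi (iotaE M x) = iotaE M x) ->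
  (forall m, m \in M' -> phi (iotaM m) = iotaM m) ->
  forall f, phi (retr f) = retr f.
Proof.
move=> cphi phiE phiM; apply: (@filtered_eq _ _ _ (phi \o retr) retr) => /=.
- by move=> i f Ff; apply/cphi/retr_filtered.
- exact: retr_filtered.
- by move=> x; rewrite retr_iotaE.
- by move=> m; rewrite retr_iotaM phiM ?memv_pi.
Qed.

Lemma retr_id f : retr (retr f) = retr f.
Proof.
apply: morph_retr; first exact: retr_filtered.
  exact: retr_iotaE.
exact: retr_iotaM_id.
Qed.

Lemma tE_subpow i m (x : tpow M i) : m \in M' -> x \in subpow M' i ->
  (tE m x : tpow M i.+1) \in subpow M' i.+1.
Proof.
have [bl br] := tE_bilin M (tpow M i).
rewrite -{1}(span_basis (vbasisP M')) -{1}(span_basis (vbasisP (subpow M' i))).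
move=> Mm Xx.
apply: (span_lin (bl x) _ Mm) => u Mu.
apply: (span_lin (br u) _ Xx) => v Xv.
by apply: memv_span; apply/allpairsP; exists (u, v).
Qed.

(** Each letter of a word is projected to M', so that the image of the word comes
    from a tensor power of M'. *)
Lemma retr_homog i (x : tpow M i) :
  exists2 y, y \in subpow M' i & retr (homog x) = homog y.
Proof.
elim: i x => [|i IH] x.
  by exists x; rewrite ?memvf // homog0 retr_iotaE.
elim/tpow_ind: x => [|a m u x [y Xy Dy]].
  by exists 0; rewrite ?mem0v // (lin0 (@homog_linear _ _ _ _)) linear0.
have [v Xv Dv] := IH u.
exists (a *: (tE (daddv_pi M' N m) v : tpow M i.+1) + y).
  by rewrite rpredD ?rpredZ // tE_subpow ?memv_pi.
by rewrite homog_linear linearP /= Dy homogS rmorphM /= retr_iotaM Dv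
           -homogS -homog_linear.
Qed.

Lemma retr_subctens f : subctens M' (retr f).
Proof.
move=> i; have := @homog_dense _ _ _ i.+1 f => /retr_filtered.
rewrite linearB linear_sum /= => /(_ i (ltnSn i)).
rewrite ctensD ctensN ctens_sum => /eqP; rewrite subr_eq0 => /eqP ->.
apply: rpred_sum => j _; have [y Xy ->] := retr_homog (f j).
rewrite /homog; case: (eqVneq (j : nat) i) => [ji|ji]; last first.
  by rewrite tto_ne ?mem0v.
by move: y Xy; rewrite ji => y Xy; rewrite tto_refl.
Qed.

End Retraction.

(** * Reducing the ideal of N modulo commutators *)

Section Generators.
Variables (F : fieldType) (E : falgType F) (n : nat) (E_ : 'I_n -> {aspace E}).
Hypothesis prodE : is_product E_.
Local Notation e := (factor_unit E_).
Variables (M : bimodType E) (N : {vspace M}) (U : seq M).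
Hypotheses (uniqU : uniq U) (genU : directed_generators e N U).
Local Notation idem i := (iotaE M (e i)).

(** The elements x a y, with a in U and x, y in a basis of E, span a
    sub-bimodule that contains U, hence N. *)
Lemma generators_ind (P : M -> Prop) : P 0 ->
  (forall k u v, P u -> P v -> P (k *: u + v)) ->
  (forall x y a, a \in U -> P (ract (lact x a) y)) ->
  forall m, m \in N -> P m.
Proof.
move=> P0 PD PU m.
pose B := [seq stdb i | i <- enum 'I_(dim E)].
pose s := [seq ract (lact xy.1 a) xy.2
             | a <- U, xy <- [seq (x, y) | x <- B, y <- B]].
have inB i : stdb i \in B by apply: map_f; rewrite mem_enum.
have s_gen a x y : a \in U -> ract (lact x a) y \in <<s>>%VS.
  move=> Ua; apply: (linear_mem (f := fun x => ract (lact x a) y)) => [k u v|i].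
    by rewrite lact_linl ract_linl.
  apply: (linear_mem (f := fun y => ract _ y)) => [|j]; first exact: ract_linr.
  apply: memv_span; apply/allpairsP; exists (a, (stdb i, stdb j)).
  split=> //; apply/allpairsP; exists (stdb i, stdb j).
  by split=> //; apply: inB.
have sP u : u \in s -> exists x y a, a \in U /\ u = ract (lact x a) y.
  by case/allpairsP => -[a [x y]] /= [Ua _ ->]; exists x, y, a.
have bs : sub_bimod <<s>>%VS.
  move=> x u su; split; move: u su; apply: span_lin.
  - exact: lact_linr.
  - move=> _ /sP[x' [y [a [Ua ->]]]].
    by rewrite -lractA -lactA s_gen.
  - exact: ract_linl.
  - move=> _ /sP[x' [y [a [Ua ->]]]].
    by rewrite -ractA s_gen.
have [_ _ /(_ _ bs) minN] := genU.
have /subvP NS : (N <= <<s>>)%VS.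
  by apply: minN => a Ua; rewrite -[a]lact1 -[lact 1 a]ract1 s_gen.
move/NS; apply: span_ind => // k _ v /sP[x [y [a [Ua ->]]]] Pv.
by apply: PD => //; apply: PU.
Qed.

Definition gen_sum (q : M -> ctens M) := \sum_(a <- U) iotaM a * q a.

Definition cyc_reduces d (f : ctens M) :=
  exists2 q : M -> ctens M,
    forall a, Fge d.-1 (q a) & commutators (f - gen_sum q).

Lemma cyc_reduces0 d : cyc_reduces d 0.
Proof.
exists (fun=> 0) => //; rewrite /gen_sum big1 ?subr0; first exact: commutators0.
by move=> a _; rewrite mulr0.
Qed.

Lemma cyc_reduces_linear d k f g :
  cyc_reduces d f -> cyc_reduces d g -> cyc_reduces d (k *: f + g).
Proof.
move=> [q Fq Cq] [r Fr Cr]; exists (fun a => k *: q a + r a).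
  by move=> a; apply: FgeD => //; apply: FgeZ.
have -> : gen_sum (fun a => k *: q a + r a) = k *: gen_sum q + gen_sum r.
  rewrite /gen_sum scaler_sumr -big_split; apply: eq_bigr => a _ /=.
  by rewrite mulrDr -scalerAr.
by rewrite opprD addrACA -scalerBr; apply: commutators_linear.
Qed.

(** For m = x a y, rotate f (x a y) g into a (y g f x). *)
Lemma cyc_reduces_gen s t f m g : m \in N -> Fge s f -> Fge t g ->
  cyc_reduces (s + t).+1 (f * iotaM m * g).
Proof.
move=> Nm Ff Fg; elim/generators_ind: m / Nm => [|k u v Ru Rv|x y a Ua].
- rewrite (lin0 (@iotaM_linear _ _ _)) mulr0 mul0r; exact: cyc_reduces0.
- rewrite iotaM_linear mulrDr mulrDl -scalerAr -scalerAl.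
  exact: cyc_reduces_linear.
pose q := iotaE M y * g * f * iotaE M x.
exists (fun b => if b == a then q else 0) => [b|].
  case: eqP => // _; rewrite /= addnC; apply/FgeMl/FgeM => //.
  exact: FgeMr.
rewrite /gen_sum (bigD1_seq a) //= eqxx big1 ?addr0 => [|b /negPf ->].
  rewrite -iotaM_ract -iotaM_lact.
  have -> : f * (iotaE M x * iotaM a * iotaE M y) * g =
            (f * iotaE M x) * (iotaM a * (iotaE M y * g)) by rewrite !mulrA.
  have -> : iotaM a * q = (iotaM a * (iotaE M y * g)) * (f * iotaE M x).
    by rewrite /q !mulrA.
  exact: commutators_comm.
by rewrite mulr0.
Qed.

Section Retract.
Variable M' : {vspace M}.
Hypotheses (bN : sub_bimod N) (bM' : sub_bimod M').
Hypotheses (NM1 : (N + M')%VS = fullv) (NM0 : (N :&: M')%VS = 0%VS).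
Local Notation retr := (retr bN bM' NM1 NM0).

(** Telescoping: a word minus the word of its projections is a sum of words, in
    the j-th of which the letters before the j-th are projected to M' and the
    j-th is projected to N. *)
Lemma cyc_reduces_retr d (x : tpow M d) :
  cyc_reduces d (homog x - retr (homog x)).
Proof.
suff red s f : Fge s f -> cyc_reduces (s + d) (f * (homog x - retr (homog x))).
  by rewrite -[_ - _]mul1r; apply: red (Fge0 _).
elim: d x s f => [|d IH] x s f Ff.
  by rewrite homog0 retr_iotaE subrr mulr0; apply: cyc_reduces0.
elim/tpow_ind: x => [|k m u x IHx].
  rewrite (lin0 (@homog_linear _ _ _ _)) linear0 subrr mulr0.
  exact: cyc_reduces0.
rewrite homog_linear linearP /= opprD addrACA -scalerBr mulrDr -scalerAr.
apply: cyc_reduces_linear IHx; rewrite homogS rmorphM /= retr_iotaM.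
have Dm : iotaM m = iotaM (daddv_pi N M' m) + iotaM (daddv_pi M' N m).
  rewrite -{1}(@daddv_pi_add _ _ N M' m NM0) ?NM1 ?memvf //.
  have := @iotaM_linear _ _ M 1 (daddv_pi N M' m) (daddv_pi M' N m).
  by rewrite !scale1r.
rewrite {1}Dm mulrDl -addrA -mulrBr mulrDr -[X in cyc_reduces _ X]addrC.
rewrite -[X in X + _]scale1r; apply: cyc_reduces_linear.
  rewrite mulrA -addSnnS; apply: IH; rewrite -addn1; apply: FgeM => //.
  exact: Fge_iotaM.
rewrite mulrA addnS; apply: cyc_reduces_gen => //; first exact: memv_pi.
exact: Fge_homog.
Qed.

End Retract.

Variables (A : {set 'I_n * 'I_n}) (hat : 'I_n -> 'I_n -> M -> M).
Hypothesis cycN : two_cycle_complete e N U A hat.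
Local Notation Uij := (Uij e N U).

Lemma mem_Uij i j a : (a \in Uij i j) = (a \in corner e i j N) && (a \in U).
Proof. exact: mem_filter. Qed.

Lemma corner_id i j a : a \in corner e i j N -> ract (lact (e i) a) (e j) = a.
Proof.
move/cornerP => [m _ ->].
by rewrite -!lractA -ractA -lactA !factor_unitM // !eqxx.
Qed.

Lemma iotaM_corner i j a : a \in corner e i j N ->
  supported E_ i j (iotaM a).
Proof. by move=> Na; rewrite /supported iotaM_lact iotaM_ract corner_id. Qed.

(** A vector of two different corners is fixed by two orthogonal idempotents on
    the same side, hence zero. *)
Lemma corner_uniq i j i' j' a : a != 0 ->
  a \in corner e i j N -> a \in corner e i' j' N -> (i, j) = (i', j').
Proof.
move=> a0 /corner_id Da /corner_id Da'; apply/eqP; apply: contraNT a0 => ij.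
apply/eqP; rewrite -Da -Da' -!lractA -lactA -ractA !factor_unitM //.
move: ij; rewrite xpair_eqE; case: (i == i') => /= [/negPf ij|_].
  by rewrite eq_sym ij (lin0 (ract_linr _)).
by rewrite (lin0 (lact_linl _)) (lin0 (ract_linl _)).
Qed.

Lemma U_corner a : a \in U -> exists i j, a \in Uij i j.
Proof.
have [subU dirU _] := genU => Ua; have [j [i Da]] := dirU a Ua.
exists i, j; rewrite mem_Uij Ua andbT; apply/cornerP; exists a => //.
exact: subU.
Qed.

Lemma polar_cases i j a : a != 0 -> a \in Uij i j ->
  ((i, j) \in A) = ((j, i) \notin A).
Proof.
move=> a0; rewrite mem_Uij => /andP[Na _].
have [[polA polN] _] := cycN.
have ij0 : corner e i j N != 0%VS.
  by apply: contraNneq a0 => ij0; rewrite -memv0 -ij0.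
case: (polN i j ij0) => ijA; have [_ nA] := polA _ _ ijA;
  by rewrite ijA (negPf nA).
Qed.

(** The coefficient of a generator a = e_i a e_j is cut down to e_j q_a e_i.
    The zero vector may belong to U, and it lies in all corners at once; its
    coefficient is set to 0, which is directed for all of them. *)
Definition directed_part (q : M -> ctens M) (a : M) : ctens M :=
  if a == 0 then 0 else
  if [pick p | a \in Uij p.1 p.2] is Some p then idem p.2 * q a * idem p.1
  else 0.

Lemma directed_part0 q : directed_part q 0 = 0.
Proof. by rewrite /directed_part eqxx. Qed.

Lemma directed_partE q i j a : a != 0 -> a \in Uij i j ->
  directed_part q a = idem j * q a * idem i.
Proof.
move=> a0 Ua; rewrite /directed_part (negPf a0); case: pickP => [p|/(_ (i, j))].
  move: Ua; rewrite !mem_Uij => /andP[Na _] /andP[Na' _].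
  by have [-> ->] := corner_uniq a0 Na Na'.
by rewrite Ua.
Qed.

Lemma directed_part_idem q i j a : a \in Uij i j ->
  supported E_ j i (directed_part q a).
Proof.
move=> Ua; have [->|a0] := eqVneq a 0.
  by rewrite directed_part0 /supported mulr0 mul0r.
by rewrite (directed_partE _ a0 Ua); apply: supported_idem.
Qed.

Lemma Fge_directed_part d q a : Fge d (q a) -> Fge d (directed_part q a).
Proof.
move=> Fq; rewrite /directed_part; case: ifP => // _; case: pickP => // p _.
exact/FgeMl/FgeMr.
Qed.

Lemma hat_Uij i j a : (i, j) \in A -> a \in Uij i j -> hat i j a \in Uij j i.
Proof. by case: cycN => _ H /H[+ _ _] => /[apply]. Qed.

Lemma directed_part_coefs q :
  directed_coefs e N U A hat (directed_part q) (directed_part q).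
Proof.
move=> i j ijA a Ua; split; first exact: directed_part_idem.
exact/directed_part_idem/hat_Uij.
Qed.

(** a q_a = e_i (a e_j q_a), and moving e_i to the right end gives
    a (e_j q_a e_i). *)
Lemma gen_sum_directed q : commutators (gen_sum q - gen_sum (directed_part q)).
Proof.
rewrite -sumrB big_seq; apply: commutators_sum => a Ua.
have [->|a0] := eqVneq a 0.
  by rewrite (lin0 (@iotaM_linear _ _ _)) !mul0r subrr; apply: commutators0.
have [i [j Uija]] := U_corner Ua; rewrite (directed_partE _ a0 Uija).
move: (Uija); rewrite mem_Uij => /andP[Na _].
have -> : iotaM a * q a = idem i * (iotaM a * idem j * q a).
  by rewrite {1}(iotaM_corner Na) !mulrA.
have -> : iotaM a * (idem j * q a * idem i) = iotaM a * idem j * q a * idem i.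
  by rewrite !mulrA.
exact: commutators_comm.
Qed.

Lemma sum_hat (G : M -> ctens M) i j : (i, j) \in A ->
  \sum_(a <- Uij i j) G (hat i j a) = \sum_(b <- Uij j i) G b.
Proof.
case: cycN => _ H /H[hatU hat_inj hat_surj].
rewrite -(big_map (hat i j) xpredT G); apply: perm_big; apply: uniq_perm.
- by rewrite map_inj_in_uniq ?filter_uniq.
- exact: filter_uniq.
move=> b; apply/mapP/idP => [[a /hatU Ua ->] //|/hat_surj[a Ua <-]].
by exists a.
Qed.

Lemma sum_corners (G : M -> ctens M) : G 0 = 0 ->
  \sum_(p : 'I_n * 'I_n) \sum_(a <- Uij p.1 p.2) G a = \sum_(a <- U) G a.
Proof.
move=> G0; under eq_bigr do rewrite big_filter big_mkcond /=.
rewrite exchange_big big_seq [RHS]big_seq; apply: eq_bigr => a Ua /=.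
have [->|a0] := eqVneq a 0.
  by rewrite G0 big1 // => p _; case: ifP.
have [i [j]] := U_corner Ua; rewrite mem_Uij => /andP[Na _].
rewrite (bigD1 (i, j)) //= Na big1 ?addr0 // => -[i' j'] /= ij.
by case: ifP => // Na'; rewrite (corner_uniq a0 Na Na') eqxx in ij.
Qed.

(** Each nonzero generator lies in one corner (i, j), and the polarization
    contains exactly one of (i, j) and (j, i). *)
Lemma sum_polar (G : M -> ctens M) : G 0 = 0 ->
  \sum_(p in A) (\sum_(a <- Uij p.1 p.2) G a + \sum_(b <- Uij p.2 p.1) G b) =
  \sum_(a <- U) G a.
Proof.
move=> G0; rewrite -(sum_corners G0) big_split /=.
pose swap (p : 'I_n * 'I_n) := (p.2, p.1).
have swapK : involutive swap by case.
rewrite [X in _ + X](reindex_inj (inv_inj swapK)) /=.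
rewrite big_mkcond [X in _ + X]big_mkcond -big_split /=.
apply: eq_bigr => -[i j] _ /=.
have [[a a0 Ua]|Uij0] :=
    pselect (exists2 a, a != 0 & a \in Uij i j).
  by rewrite (polar_cases a0 Ua); case: ((j, i) \in A); rewrite ?addr0 ?add0r.
rewrite big_seq big1 => [|a Ua]; first by do 2!case: ifP => _; rewrite addr0.
by have [->//|a0] := eqVneq a 0; case: Uij0; exists a.
Qed.

(** The generators a in U(i, j) and b in U(j, i), for (i, j) in A, exhaust the
    nonzero elements of U; the terms q_b b of the second kind are rotated to
    b q_b. *)
Lemma gen_sum_uv q : q 0 = 0 ->
  commutators (gen_sum q - uv_sum e N U A hat q q).
Proof.
move=> q0; rewrite /gen_sum -sum_polar; last by rewrite q0 mulr0.
rewrite /uv_sum -sumrB; apply: commutators_sum => -[i j] ijA /=.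
rewrite big_split /= -(sum_hat (fun b => iotaM b * q b) ijA).
rewrite opprD addrACA subrr add0r.
by rewrite -sumrB; apply: commutators_sum => a _; apply: commutators_comm.
Qed.

Lemma potential_uv u v :
  directed_coefs e N U A hat u v -> potential e (uv_sum e N U A hat u v).
Proof.
move=> duv; apply: potential_sum => // -[i j] ijA /=.
rewrite big_seq; apply: potential_sum => // a Ua.
have [Du Dv] := duv i j ijA a Ua.
move: (Ua) (hat_Uij ijA Ua); rewrite !mem_Uij => /andP[Na _] /andP[Nb _].
apply: potentialD => //; apply: (potential_supported prodE).
  exact: supportedM (iotaM_corner Na) Du.
exact: supportedM Dv (iotaM_corner Nb).
Qed.

Lemma potential_QN : potential e (QN e N U A hat).
Proof.
apply: potential_sum => // -[i j] ijA /=.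
rewrite big_seq; apply: potential_sum => // a Ua.
move: (Ua) (hat_Uij ijA Ua); rewrite !mem_Uij => /andP[Na _] /andP[Nb _].
apply: (potential_supported prodE).
exact: supportedM (iotaM_corner Na) (iotaM_corner Nb).
Qed.

Lemma closed_ideal_uv u v : closed_ideal N (uv_sum e N U A hat u v).
Proof.
apply: sub_fclosure => I [[I0 ID IM] NI].
have [subU _ _] := genU.
apply: (big_ind I) => // -[i j] ijA /=.
rewrite big_seq; apply: (big_ind I) => // a Ua; have Ub := hat_Uij ijA Ua.
have IU b i' j' : b \in Uij i' j' -> I (iotaM b).
  by rewrite mem_Uij => /andP[_ /subU Nb]; apply: NI; exists b.
apply: ID.
  by rewrite -[iotaM a]mul1r; apply/IM/(IU _ _ _ Ua).
by rewrite -[_ * _]mulr1; apply/IM/(IU _ _ _ Ub).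
Qed.

Lemma Fge_uv l u v : (forall a, Fge l (u a)) -> (forall a, Fge l (v a)) ->
  Fge l.+1 (uv_sum e N U A hat u v).
Proof.
move=> Fu Fv; apply: Fge_sum => p _; apply: Fge_sum => a _; apply: FgeD.
  by rewrite -add1n; apply: FgeM => //; apply: Fge_iotaM.
by rewrite -addn1; apply: FgeM => //; apply: Fge_iotaM.
Qed.

End Generators.

(** * Removing the N-part degree by degree *)

Section Reduction.
Variables (F : fieldType) (E : falgType F) (n : nat) (E_ : 'I_n -> {aspace E}).
Hypothesis prodE : is_product E_.
Local Notation e := (factor_unit E_).
Variables (M : bimodType E) (N M' : {vspace M}) (U : seq M).
Variables (A : {set 'I_n * 'I_n}) (hat : 'I_n -> 'I_n -> M -> M).
Hypotheses (bN : sub_bimod N) (bM' : sub_bimod M').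
Hypotheses (NM1 : (N + M')%VS = fullv) (NM0 : (N :&: M')%VS = 0%VS).
Hypotheses (uniqU : uniq U) (genU : directed_generators e N U).
Hypothesis cycN : two_cycle_complete e N U A hat.
Local Notation retr := (retr bN bM' NM1 NM0).
Local Notation Q_N := (QN e N U A hat).
Local Notation uv := (uv_sum e N U A hat).

Hypothesis dual_bimod_morphism : forall u v : M -> ctens M,
  directed_coefs e N U A hat u v ->
  exists2 rho : M -> ctens M, bimod_morphism_on N rho &
    forall i j, (i, j) \in A -> forall a, a \in Uij e N U i j ->
      rho a = - v (hat i j a) /\ rho (hat i j a) = - u a.

(** phi extends m |-> m + rho (projection of m to N).  The values of rho on the
    generators have order at least d + 1, hence so do all its values on N.  The
    error in the conclusion is the sum of the products v_b u_a. *)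
Lemma dual_automorphism d (u v : M -> ctens M) :
  directed_coefs e N U A hat u v ->
  (forall a, Fge d.+1 (u a)) -> (forall a, Fge d.+1 (v a)) ->
  exists phi : {lrmorphism ctens M -> ctens M},
    [/\ shifts d phi, forall x, phi (iotaE M x) = iotaE M x,
        forall m, m \in M' -> phi (iotaM m) = iotaM m
      & Fge (d.+1 + d.+1) (phi Q_N - (Q_N - uv u v))].
Proof.
move=> duv Fu Fv; have [rho rhoB rhoUV] := dual_bimod_morphism duv.
pose rho' := rho \o daddv_pi N M'.
have rho'B : bimod_morphism_on fullv rho' by apply: extend_bimod.
have rho'N m : m \in N -> rho' m = rho m.
  by move=> Nm; rewrite /rho' /= daddv_pi_id.
have [subU _ _] := genU; have [_ hatP] := cycN.
have UN i j a : a \in Uij e N U i j -> a \in N.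
  by rewrite mem_Uij => /andP[_ /subU].
have rho'0 : rho' 0 = 0.
  by apply: (lin0 (f := rho')) => k x y; apply: (proj1 rho'B); rewrite memvf.
have FrhoN m : m \in N -> Fge d.+1 (rho' m).
  apply: (generators_ind genU (P := fun m => Fge d.+1 (rho' m)))
    => [|k x y Fx Fy|x y a Ua].
  - by rewrite rho'0.
  - by rewrite (proj1 rho'B) ?memvf //; apply: FgeD => //; apply: FgeZ.
  rewrite (proj2 rho'B) ?memvf //; apply/FgeMl/FgeMr.
  have [->|a0] := eqVneq a 0; first by rewrite rho'0.
  have [i [j Ua']] := U_corner genU Ua; rewrite rho'N ?(UN i j) //.
  case: (boolP ((i, j) \in A)) => ijA.
    by have [-> _] := rhoUV i j ijA a Ua'; apply: FgeN.
  have jiA : (j, i) \in A.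
    by rewrite (polar_cases cycN a0 Ua') negbK in ijA.
  have [_ _ /(_ a Ua')[b Ub <-]] := hatP j i jiA.
  by have [_ ->] := rhoUV j i jiA b Ub; apply: FgeN.
have Frho m : Fge d.+1 (rho' m).
  have -> : rho' m = rho' (daddv_pi N M' m) by rewrite [RHS]rho'N ?memv_pi.
  by apply: FrhoN; apply: memv_pi.
pose g m := iotaM m + rho' m.
have gB : bimod_morphism_on fullv g.
  exact: bimod_morphism_onD (@iotaM_bimod F E M) rho'B.
have g1 m : Fge 1 (g m).
  by apply: FgeD; [apply: Fge_iotaM | apply: FgeW (Frho m)].
pose phi := ext gB g1.
have gE m : g m - iotaM m = rho' m by rewrite /g addrC addKr.
exists phi; split.
- by apply: ext_shifts => m; rewrite gE.
- exact: ext_iotaE.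
- move=> m M'm; rewrite /phi ext_iotaM /g /rho' /= daddv_pi_ker //.
  by rewrite [rho 0](_ : _ = 0) ?addr0 // -rho'N ?mem0v.
have -> : phi Q_N - (Q_N - uv u v) =
    \sum_(p in A) \sum_(a <- Uij e N U p.1 p.2) v (hat p.1 p.2 a) * u a.
  rewrite /QN /uv_sum -sumrB rmorph_sum -sumrB; apply: eq_bigr => -[i j] ijA /=.
  rewrite -sumrB rmorph_sum -sumrB big_seq [RHS]big_seq; apply: eq_bigr => a Ua.
  have [Da Db] := rhoUV i j ijA a Ua; have Ub := hat_Uij cycN ijA Ua.
  rewrite rmorphM /= /phi !ext_iotaM /g !rho'N ?(UN _ _ _ Ua) ?(UN _ _ _ Ub) //.
  rewrite Da Db mulrBr !mulrBl.
  set x := iotaM a * iotaM _; set t := v _ * iotaM _; set y := iotaM a * u a.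
  set s := v _ * u a.
  have -> : x - t - (y - s) = x - (y + t) + s.
    by rewrite opprB opprD [s - y]addrC !addrA [x - t - y]addrAC.
  by rewrite addrAC subrr add0r.
by apply: Fge_sum => p _; apply: Fge_sum => a _; apply: FgeM.
Qed.

Variable P : ctens M.

(** The state after k steps: psi is the composite of the automorphisms used so
    far, R the remainder of the potential, and the part of R in the ideal of N
    starts in degree k + 3. *)
Definition stage k (psi : {lrmorphism ctens M -> ctens M}) (R : ctens M) :=
  [/\ shifts 1 psi, forall x, psi (iotaE M x) = iotaE M x,
      Fge 3 R, Fge (k + 3) (R - retr R) & commutators (psi P - (Q_N + R))].

(** Only the component of degree k + 3 of the part in the ideal is treated; the
    new automorphism leaves retr R alone, so that all errors come from terms in
    the ideal and from the products v_b u_a, in degree 2k + 4 or more. *)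
Lemma stage_step k psi R : stage k psi R ->
  exists psi' R', [/\ stage k.+1 psi' R',
    forall f, Fge k (psi' f - psi f) & Fge k (R' - R)].
Proof.
case=> sh psiE F3R; set r := R - retr R => FR CR.
(* w agrees with the part r in the ideal in degree k + 3, and so does w', which
   is killed by retr and has the shape required by the telescoping lemma. *)
pose w := homog (r (k + 3)%N); pose w' := w - retr w.
have retr_r : retr r = 0 by rewrite linearB /= retr_id subrr.
have rw : Fge (k + 3).+1 (r - w).
  have := @homog_dense _ _ _ (k + 3).+1 r.
  rewrite big_ord_recr /= big1 ?add0r //.
  move=> i _; have -> : r i = 0 by apply: FR.
  exact: lin0 (@homog_linear _ _ _ _).
have rw' : Fge (k + 3).+1 (r - w').
  rewrite /w' opprB addrCA addrC; apply: FgeD => //.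
  rewrite -[retr w]subr0 -retr_r -linearB.
  exact/retr_filtered/FgeBC.
have Fw' : Fge (k + 3) w'.
  by apply: FgeB; [|apply: retr_filtered]; apply: Fge_homog.
have retr_w' : retr w' = 0 by rewrite linearB /= retr_id subrr.
have [q Fq Cq] : cyc_reduces U (k + 3) w'.
  exact: (cyc_reduces_retr uniqU genU).
clearbody w'.
pose q' := directed_part E_ N U q.
have Fq' a : Fge k.+2 (q' a).
  by apply: Fge_directed_part; move: (Fq a); rewrite addn3.
have Cw : commutators (w' - uv q' q').
  rewrite -(subrKA (gen_sum U q)); apply: commutatorsD => //.
  rewrite -(subrKA (gen_sum U q')); apply: commutatorsD.
    exact: (gen_sum_directed prodE genU).
  exact/(gen_sum_uv prodE uniqU genU cycN)/directed_part0.
have dq' : directed_coefs e N U A hat q' q' by apply: directed_part_coefs.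
have [phi [shp phiE phiM Ft1]] := dual_automorphism dq' Fq' Fq'.
set t1 := phi Q_N - _ in Ft1.
have cphi := shifts_filtered shp.
have shp1 : shifts 1 phi by apply: shiftsW shp.
pose t2 := phi r - r.
have Ft : Fge (k + 3).+1 (t1 + t2).
  apply: FgeD; first by apply: FgeW Ft1; rewrite addn3 !addnS !ltnS leq_addl.
  by apply: FgeW (shp _ _ FR); rewrite -[(k + 3).+1]addn1 leq_add2l.
have F3 f : Fge (k + 3).+1 f -> Fge 3 f.
  by apply: FgeW; rewrite -addSn leq_addl.
have DQ : phi Q_N = Q_N - uv q' q' + t1 by rewrite addrC subrK.
have DR : phi R = R + t2.
  rewrite -[R in LHS](subrK (retr R)) linearD /= (morph_retr _ _ _ _ cphi) //.
  by rewrite /t2 [R + _]addrCA subKr.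
exists (phi \o psi), (R - w' + (t1 + t2)); split; last 1 first.
- rewrite addrAC [R - w']addrC addrK; apply: FgeD.
    by apply/FgeN/(FgeW _ Fw')/leq_addr.
  by apply: FgeW Ft; apply: leq_trans (leq_addr 3 k) (leqnSn _).
- split.
  + exact: shifts_comp.
  + by move=> x /=; rewrite psiE.
  + apply: FgeD; last exact: F3.
    by apply: FgeB => //; apply: FgeW Fw'; rewrite leq_addl.
  + rewrite linearD /= [retr (R - w')]linearB /= retr_w' subr0 opprD addrACA.
    rewrite [R - w' - _]addrAC; apply: FgeD => //.
    by apply: FgeB => //; apply: retr_filtered.
  pose z := psi P - (Q_N + R).
  rewrite [X in X - _](_ : _ = phi z + (phi Q_N + phi R)); last first.
    by rewrite /z linearB linearD /= subrK.
  rewrite DQ DR -addrA.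
  rewrite [X in phi z + X](_ : _ = w' - uv q' q').
    by apply: commutatorsD => //; apply: commutators_morph.
  apply/eqP; rewrite subr_eq; apply/eqP.
  by rewrite [RHS](AC (2*(1*(2*2))) ((1*5)*((3*2*6)*(4*7)))) /= subrr add0r.
by move=> f /=; apply: FgeW (shp 0 _ (Fge0 _)); rewrite add0n leqnSn.
Qed.

Lemma reduction_limit (P3 : ctens M) : P = Q_N + P3 -> Fge 3 P3 ->
  exists phi : {lrmorphism ctens M -> ctens M}, exists R : ctens M,
  [/\ shifts 1 phi, forall x, phi (iotaE M x) = iotaE M x,
      Fge 3 R, retr R = R & commutators (phi P - (Q_N + R))].
Proof.
move=> DP F3; pose T := ({lrmorphism ctens M -> ctens M} * ctens M)%type.
have [s [s0 sS]] : exists s : nat -> T,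
    stage 0 (s 0).1 (s 0).2 /\ forall k, stage k (s k).1 (s k).2 ->
    [/\ stage k.+1 (s k.+1).1 (s k.+1).2,
      forall f, Fge k ((s k.+1).1 f - (s k).1 f)
      & Fge k ((s k.+1).2 - (s k).2)].
  (* A step is defined for every pair, so that the choice can be iterated; it is
     only informative when t satisfies the invariant. *)
  have next k (t : T) : exists t' : T, stage k t.1 t.2 ->
      [/\ stage k.+1 t'.1 t'.2, forall f, Fge k (t'.1 f - t.1 f)
        & Fge k (t'.2 - t.2)].
    have [/stage_step[psi [R' ?]]|nst] := pselect (stage k t.1 t.2).
      by exists (psi, R').
    by exists t => /nst.
  pose fix s k : T :=
    if k is k'.+1 then sval (cid (next k' (s k')))
    else (idfun : {lrmorphism ctens M -> ctens M}, P3).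
  exists s; split=> [|k]; last exact: svalP (cid (next k (s k))).
  split=> //=.
  - by move=> i f _; rewrite subrr.
  - by apply: FgeB => //; apply: retr_filtered.
  - by rewrite DP subrr; apply: commutators0.
have st k : stage k (s k).1 (s k).2 by elim: k => [//|k /sS[]].
have [|phi lim] := @lrmorphism_lim _ _ M (fun k => (s k).1).
  by move=> k; case: (sS k (st k)).
have limR : forall k, Fge k (flim (fun k => (s k).2) - (s k).2).
  by apply: Fge_flim => k; case: (sS k (st k)).
set R := flim _ in limR.
exists phi, R; split.
- move=> i f Ff; rewrite addn1; apply: (FgeBtrans (lim i.+1 f)).
  by have [sh _ _ _ _] := st i.+1; have := sh i f Ff; rewrite addn1.
- move=> x; apply/eqP; rewrite -subr_eq0; apply/eqP/Fge_eq0 => k.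
  by have [_ sE _ _ _] := st k; have := lim k (iotaE M x); rewrite sE.
- rewrite -(subrK (s 3).2 R); apply: FgeD => //.
  by have [_ _ F3R _ _] := st 3.
- apply/eqP; rewrite eq_sym -subr_eq0; apply/eqP/Fge_eq0 => k.
  apply: (FgeBtrans (limR k)); apply: (@FgeBtrans _ _ _ _ _ (retr (s k).2)).
    by have [_ _ _ FR _] := st k; apply: FgeW FR; rewrite leq_addr.
  by rewrite -linearB; apply/retr_filtered/FgeBC.
apply: commutators_lim => k; exists ((s k).1 P - (Q_N + (s k).2)).
  by have [_ _ _ _ Ck] := st k.
rewrite [- (_ - _)]opprD opprK addrACA [- (_ + R)]opprD [X in _ + X]addrACA.
by rewrite addNr add0r addrC; apply: FgeD; [rewrite addrC; apply/FgeBC/limR|].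
Qed.

End Reduction.

Theorem theorem6p3 (F : fieldType) (E : falgType F)
    (n : nat) (E_ : 'I_n -> {aspace E})
    (M : bimodType E) (N M' : {vspace M})
    (U : seq M) (A : {set 'I_n * 'I_n}) (hat : 'I_n -> 'I_n -> M -> M) :
  let e := factor_unit E_ in
  is_product E_ ->
  (forall i, semisimple (subvs_of (E_ i))) ->
  semisimple (tens_alg E E^c) ->
  acyclic M e ->
  sub_bimod N -> sub_bimod M' -> (N + M')%VS = fullv -> (N :&: M')%VS = 0%VS ->
  uniq U -> directed_generators e N U ->
  two_cycle_complete e N U A hat ->
  (forall (l : nat) (u v : M -> ctens M) (z : ctens M),
     (0 < l)%N ->
     directed_coefs e N U A hat u v ->
     commutators z -> Fge l z ->
     potential e (uv_sum e N U A hat u v + z) ->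
     closed_ideal N (uv_sum e N U A hat u v + z) ->
     Fge l (uv_sum e N U A hat u v + z) ->
     exists2 rho : M -> ctens M, bimod_morphism_on N rho &
       forall i j, (i, j) \in A -> forall a, a \in Uij e N U i j ->
         rho a = - v (hat i j a) /\ rho (hat i j a) = - u a) ->
  forall P P3 : ctens M,
    potential e P -> P = QN e N U A hat + P3 -> Fge 3 P3 ->
  exists phi : {lrmorphism ctens M -> ctens M},
    [/\ bijective phi,
        forall x : E, phi (iotaE M x) = iotaE M x
      & exists Q : ctens M,
          [/\ subctens M' Q, Fge 3 Q
            & cyc_equiv e (phi P) (QN e N U A hat + Q)]].
Proof.
move=> e; rewrite /e {e} => prodE _ _ _ bN bM' NM1 NM0 uniqU genU cycN hyp.
move=> P P3 potP DP F3.
have dual u v : directed_coefs (factor_unit E_) N U A hat u v ->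
    exists2 rho : M -> ctens M, bimod_morphism_on N rho &
      forall i j, (i, j) \in A ->
      forall a, a \in Uij (factor_unit E_) N U i j ->
        rho a = - v (hat i j a) /\ rho (hat i j a) = - u a.
  move=> duv; have Fuv : Fge 1 (uv_sum (factor_unit E_) N U A hat u v).
    exact: Fge_uv.
  (* The commutator term z may be taken to be 0, and the order l to be 1: a sum of
     this form has no term in degree 0. *)
  apply: (hyp 1%N u v 0); rewrite ?addr0 //; first exact: commutators0.
    exact: (potential_uv prodE cycN).
  exact: (closed_ideal_uv genU cycN).
have [phi [R [sh phiE F3R retrR CR]]] :=
  reduction_limit prodE bN bM' NM1 NM0 uniqU genU cycN dual DP F3.
exists phi; split=> //; first exact: shifts_bij.
exists (diag_part E_ R); split.
- rewrite -[R]retrR; have -> : diag_part E_ (retr bN bM' NM1 NM0 R) =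
      retr bN bM' NM1 NM0 (diag_part E_ R).
    rewrite linear_sum; apply: eq_bigr => i _.
    by rewrite !rmorphM /= retr_iotaE.
  exact: retr_subctens.
- by apply: Fge_sum => i _; apply/FgeMl/FgeMr.
split.
- rewrite /potential {1}potP linear_sum; apply: eq_bigr => i _.
  by rewrite !rmorphM /= !phiE.
- apply: potentialD; first exact: (potential_QN prodE cycN).
  exact: potential_diag_part.
rewrite -(subrKA (QN (factor_unit E_) N U A hat + R)); apply: commutatorsD => //.
by rewrite opprD addrACA subrr add0r; apply: diag_part_cyc.
Qed.
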